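(* Let $n\ge 4$, let $\mathbb{K}$ be a field, and let $G$ be a finite simple graph on $[n]$ with no isolated vertices. Then the following are equivalent: (1) $S/I_c(G)$ is Gorenstein. (2) $G$ is the disjoint union of two edges.
   Context: $S=\mathbb{K}[x_1,\dots,x_n]$ is the standard graded polynomial ring and $[n]=\{1,\dots,n\}$. For a simple graph $G$ with vertex set $[n]$ and edge set $E(G)$, the complementary edge ideal is $I_c(G)=(x_1\cdots x_n/(x_ix_j) : \{i,j\}\in E(G))\subset S$. *)

(* Defs.v *)
From HB Require Import structures.
From mathcomp Require Import all_boot all_order all_algebra.
From mathcomp.multinomials Require Import mpoly.

Set Implicit Arguments.
Unset Strict Implicit.
Unset Printing Implicit Defensive.

Import GRing.Theory.
Local Open Scope ring_scope.

(* Ideals are Prop-valued predicates: the boolean ideals of ring_quotient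
   would only account for ideals with decidable membership.  A quotient R/I
   is represented by the ideal I of R; its ideals are the ideals of R that
   contain I. *)
Section Ideals.
Variable R : comNzRingType.
Implicit Types (I J P : R -> Prop) (s : seq R).

Definition is_ideal I : Prop :=
  [/\ I 0, forall f g, I f -> I g -> I (f + g) & forall a f, I f -> I (a * f)].

Definition is_prime_ideal P : Prop :=
  [/\ is_ideal P, ~ P 1 & forall f g, P (f * g) -> P f \/ P g].

Definition ideal_gen (F : R -> Prop) : R -> Prop := fun f =>
  exists m (a g : 'I_m -> R), (forall i, F (g i)) /\ f = \sum_i a i * g i.

Definition ideal_adjoin I s : R -> Prop := ideal_gen (fun f => I f \/ f \in s).

Definition prime_chain I (d : nat) : Prop :=
  exists P : nat -> R -> Prop,
    (forall i, (i <= d)%N ->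
       is_prime_ideal (P i) /\ (forall f, I f -> P i f)) /\
    (forall i, (i < d)%N ->
       (forall f, P i f -> P i.+1 f) /\ (exists f, P i.+1 f /\ ~ P i f)).

(* krull_dim I d : the Krull dimension of R/I is d. *)
Definition krull_dim I (d : nat) : Prop :=
  prime_chain I d /\ (forall e, prime_chain I e -> (e <= d)%N).

(* s is a regular sequence on the ring R/I. *)
Definition regular_seq I s : Prop :=
  ~ ideal_adjoin I s 1 /\
  forall i, (i < size s)%N -> forall f,
    ideal_adjoin I (take i s) (s`_i * f) -> ideal_adjoin I (take i s) f.

End Ideals.

Section GradedQuotients.
Variables (n : nat) (K : fieldType).
Local Notation S := {mpoly K[n]}.
Implicit Types (I J U : S -> Prop) (s : seq S).

(* For K-subspaces J of U: the K-vector space U/J has dimension r. *)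
Definition quot_dim U J (r : nat) : Prop :=
  exists b : 'I_r -> S,
    [/\ forall i, U (b i),
        forall f, U f -> exists c : 'I_r -> K, J (f - \sum_i c i *: b i)
      & forall c : 'I_r -> K, J (\sum_i c i *: b i) -> forall i, c i = 0].

(* The colon ideal J : (x_1, ..., x_n), whose image in S/J is the socle. *)
Definition colon_max J : S -> Prop := fun f => forall i : 'I_n, J ('X_i * f).

(* s is a homogeneous system of parameters of S/I. *)
Definition hsop I s : Prop :=
  [/\ krull_dim I (size s),
      forall t, t \in s -> exists2 d, (0 < d)%N & t \is d.-homog
    & exists r, quot_dim (fun=> True) (ideal_adjoin I s) r].

(* For a homogeneous ideal I: the standard graded K-algebra S/I is
   Cohen-Macaulay (it has a homogeneous system of parameters s which is a
   regular sequence) of type r = dim_K Soc(S/(I + (s))).  The type does not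
   depend on the choice of s. *)
Definition cohen_macaulay_of_type I (r : nat) : Prop :=
  exists s, [/\ hsop I s, regular_seq I s &
    quot_dim (colon_max (ideal_adjoin I s)) (ideal_adjoin I s) r].

Definition gorenstein I : Prop := cohen_macaulay_of_type I 1.

Definition complementary_edge_ideal (e : rel 'I_n) : S -> Prop :=
  ideal_gen (fun f => exists i j : 'I_n,
    e i j /\ f = \prod_(k | (k != i) && (k != j)) 'X_k).

End GradedQuotients.

Definition simple_graph (n : nat) (e : rel 'I_n) : Prop :=
  (forall i, ~~ e i i) /\ (forall i j, e i j = e j i).

Definition no_isolated_vertex (n : nat) (e : rel 'I_n) : Prop :=
  forall i, exists j, e i j.

Definition two_disjoint_edges (n : nat) (e : rel 'I_n) : Prop :=
  exists a b c d : 'I_n,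
    [/\ uniq [:: a; b; c; d],
        forall v, v \in [:: a; b; c; d]
      & forall u v, e u v = ([set u; v] == [set a; b]) || ([set u; v] == [set c; d])].

(* Main.v *)
Require Import Defs.
From mathcomp Require Import all_boot all_order all_algebra.
From mathcomp.multinomials Require Import mpoly.
From mathcomp Require Import zify ring lra.
From Stdlib Require Import Classical.

Set Implicit Arguments.
Unset Strict Implicit.
Unset Printing Implicit Defensive.

Import GRing.Theory Num.Theory.
Local Open Scope ring_scope.

(** ** Why the theorem holds

   Write I for the complementary edge ideal, mu for the number of edges.  A monomial
   lies in I exactly when its zero set (the variables that do not occur in it) is
   contained in an edge; since no vertex is isolated, these zero sets are the empty set,
   the n singletons and the mu edges.  Counting monomials by their zero set
   ([deg_gen_uncovered_below]) gives the Hilbert series of S/I as q(X) / (1 - X)^n with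
     q = 1 - (X^n + n (1 - X) X^(n-1) + mu (1 - X)^2 X^(n-2)).

   Suppose S/I is Gorenstein, and let A be its quotient by a homogeneous regular sequence
   of degrees d_1, ..., d_r with a finite-dimensional quotient and a one-dimensional
   socle.  Each regular element multiplies the Hilbert series by 1 - X^d
   ([hilb_below_regular_seq]), so the Hilbert polynomial F of A satisfies
     (1 - X)^n F = q (1 - X^(d_1)) ... (1 - X^(d_r)).
   Multiplication A_k x A_(s-k) -> A_s is a perfect pairing into the one-dimensional
   socle, so F is palindromic ([hilb_symmetric]); the other factors are antipalindromic, so
   q(X) and q(1/X) agree up to a sign and a power of X ([numerator_reversal]).  Comparing
   the lowest coefficients of q with those of X^n q(1/X), namely n - 1 - mu, 2 mu - n, -mu,
   forces n = 4 and mu = 2 ([numerator_palindromic_two_edges]), and two edges that cover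
   four vertices are disjoint.

   Conversely, for the edges ab and cd we have I = (x_a x_b, x_c x_d), and x_a - x_b,
   x_c - x_d is both a system of parameters and a regular sequence: modulo these forms,
   substituting x_a for x_b and x_c for x_d turns I into (x_a^2, x_c^2)
   ([adjoin_sop_E]), so that the quotient has the basis 1, x_a, x_c, x_a x_c and the socle spanned by x_a x_c.  What remains is
   that the Krull dimension is 2.  A chain of coordinate primes gives the lower bound.
   For the upper bound, a prime containing I contains an endpoint of each edge, and a chain
   of primes P_0 < ... < P_e with f_i in P_(i+1) outside P_i makes f_0, ..., f_(e-1)
   algebraically independent modulo P_0; counting the N^e products of powers of the f_i
   against the monomials in the remaining variables gives e <= 2
   ([prime_chain_length_le]). *)

(** * Linear algebra modulo a subspace *)

Section LinearAlgebraModulo.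
Variables (K : fieldType) (V : lmodType K).
Implicit Types (U J : V -> Prop).

(** Subspaces are predicates, like the ideals they come from; bases are families indexed by
    an arbitrary finite type, so that disjoint unions and products of index types give bases
    without renumbering. *)
Definition subspace J : Prop :=
  [/\ J 0, forall f g, J f -> J g -> J (f + g) & forall (a : K) f, J f -> J (a *: f)].

Definition indep_mod J (T : finType) (b : T -> V) : Prop :=
  forall c : T -> K, J (\sum_t c t *: b t) -> forall t, c t = 0.

Definition span_mod U J (T : finType) (b : T -> V) : Prop :=
  forall f, U f -> exists c : T -> K, J (f - \sum_t c t *: b t).

Lemma subspaceN J f : subspace J -> J f -> J (- f).
Proof. by case=> _ _ HZ Jf; rewrite -scaleN1r; apply: HZ. Qed.

Lemma subspaceB J f g : subspace J -> J f -> J g -> J (f - g).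
Proof. by move=> HJ Jf Jg; case: (HJ) => _ HD _; apply: HD => //; apply: subspaceN. Qed.

Lemma subspace_sum J (I : Type) (r : seq I) (P : pred I) (F : I -> V) :
  subspace J -> (forall i, P i -> J (F i)) -> J (\sum_(i <- r | P i) F i).
Proof. by case=> H0 HD _ HF; elim/big_ind: _. Qed.

(** More rows than columns force a linear relation between the rows. *)
Lemma left_kernel_exists (T' T : finType) (M : T' -> T -> K) :
  (#|T| < #|T'|)%N ->
  exists2 v : T' -> K, (exists t', v t' != 0) & forall t, \sum_t' v t' * M t' t = 0.
Proof.
move=> ltT; pose A := \matrix_(i < #|T'|, j < #|T|) M (enum_val i) (enum_val j).
have : kermx A != 0.
  rewrite kermx_eq0; apply/negP => /eqP rA.
  by have := rank_leq_col A; rewrite rA leqNgt ltT.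
case/rowV0Pn => w /sub_kermxP wA0 w0.
exists (fun t' => w ord0 (enum_rank t')).
  have [j wj] : exists j, w ord0 j != 0.
    by move: w0 => /matrix0Pn [i [j]]; rewrite ord1; exists j.
  by exists (enum_val j); rewrite enum_valK.
move=> t; have := congr1 (fun B : 'rV_ _ => B ord0 (enum_rank t)) wA0.
rewrite !mxE => wA; rewrite -[RHS]wA (reindex (fun i : 'I_#|T'| => enum_val i)) /=; last first.
  exact/onW_bij/enum_val_bij.
by apply: eq_bigr => i _; rewrite !mxE enum_valK enum_rankK.
Qed.

(** Steinitz: the coordinates of the independent family in the spanning one form a matrix,
    and with too many rows a relation between them would be a relation modulo J. *)
Lemma indep_card_le U J (T T' : finType) (b : T -> V) (b' : T' -> V) :
  subspace J -> span_mod U J b -> (forall t, U (b' t)) -> indep_mod J b' ->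
  (#|T'| <= #|T|)%N.
Proof.
move=> HJ Hspan HU Hind; rewrite leqNgt; apply/negP => ltT.
have [c Hc] := fin_all_exists (fun t => Hspan _ (HU t)).
have [v [t0 vt0] Hv] := left_kernel_exists c ltT.
move/eqP: vt0; apply; apply: Hind.
have -> : \sum_t v t *: b' t = \sum_t v t *: (b' t - \sum_u c t u *: b u).
  under [RHS]eq_bigr do rewrite scalerBr scaler_sumr.
  rewrite sumrB exchange_big /= [X in _ - X]big1 ?subr0 // => u _.
  under eq_bigr do rewrite scalerA.
  by rewrite -scaler_suml Hv scale0r.
by apply: subspace_sum => // t _; case: HJ => _ _; apply.
Qed.

Lemma indep_reindex J (T T' : finType) (h : T' -> T) (b : T -> V) :
  bijective h -> indep_mod J b -> indep_mod J (b \o h).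
Proof.
move=> [g hK gK] Hb c Hc t; rewrite -[t]hK; apply: (Hb (c \o g)).
rewrite (reindex h) /=; last by exists g => ? _.
by under eq_bigr do rewrite hK.
Qed.

Lemma span_reindex U J (T T' : finType) (h : T' -> T) (b : T -> V) :
  bijective h -> span_mod U J b -> span_mod U J (b \o h).
Proof.
move=> [g hK gK] Hb f /Hb [c Hc]; exists (c \o h).
by move: Hc; rewrite (reindex h) //=; exists g => ? _.
Qed.

Lemma indep_cons J s (b : 'I_s -> V) f : subspace J -> indep_mod J b ->
  ~ (exists c : 'I_s -> K, J (f - \sum_t c t *: b t)) ->
  indep_mod J (fun i : 'I_s.+1 => oapp b f (unlift ord0 i)).
Proof.
move=> HJ Hb Nf c; rewrite big_ord_recl unlift_none /=.
under eq_bigr do rewrite liftK /=.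
have [c0|c0 Hc] := eqVneq (c ord0) 0.
  rewrite c0 scale0r add0r => /Hb Hc i.
  by case: (unliftP ord0 i) => [j|] ->.
case: Nf; exists (fun i => - (c ord0)^-1 * c (lift ord0 i)).
rewrite -[f in f - _](scalerK c0) -sumrN.
under eq_bigr do rewrite mulNr scaleNr opprK -scalerA.
by rewrite -scaler_sumr -scalerDr; case: HJ => _ _; apply.
Qed.

(** A largest independent family spans, since otherwise [indep_cons] would enlarge it; N - s
    bounds the number of enlargements. *)
Lemma basis_exists U J (N s : nat) (b : 'I_s -> V) : subspace J ->
  (forall i, U (b i)) -> indep_mod J b ->
  (forall t (b' : 'I_t -> V), (forall i, U (b' i)) -> indep_mod J b' -> (t <= N)%N) ->
  exists t (b' : 'I_t -> V), [/\ forall i, U (b' i), span_mod U J b' & indep_mod J b'].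
Proof.
move=> HJ HU Hb Hmax; have [k] := ubnP (N - s); elim: k s b HU Hb => // k IHk s b HU Hb.
rewrite ltnS => leNs; have [Hs|/not_all_ex_not [f Hf]] := classic (span_mod U J b).
  by exists s, b.
have [Uf Nf] : U f /\ ~ exists c : 'I_s -> K, J (f - \sum_t c t *: b t).
  by apply: imply_to_and.
have HU' (i : 'I_s.+1) : U (oapp b f (unlift ord0 i)) by case: unliftP => [j|] _ /=.
have Hb' := indep_cons HJ Hb Nf.
by have := Hmax _ _ HU' Hb' => lesN; apply: IHk HU' Hb' _; lia.
Qed.

End LinearAlgebraModulo.

Section QuotDim.
Variables (n : nat) (K : fieldType).
Local Notation S := {mpoly K[n]}.
Implicit Types (U J : S -> Prop).

Lemma quot_dimP U J r : quot_dim U J r <->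
  exists b : 'I_r -> S, [/\ forall i, U (b i), span_mod U J b & indep_mod J b].
Proof. by split; case=> b [? ? ?]; exists b. Qed.

Lemma quot_dim_basis U J (T : finType) (b : T -> S) :
  (forall t, U (b t)) -> span_mod U J b -> indep_mod J b -> quot_dim U J #|T|.
Proof.
move=> HU Hs Hi; apply/quot_dimP; exists (b \o enum_val); split=> [t /=||].
- exact: HU.
- exact/span_reindex/Hs/enum_val_bij.
- exact/indep_reindex/Hi/enum_val_bij.
Qed.

Lemma quot_dim_uniq U J r r' :
  subspace J -> quot_dim U J r -> quot_dim U J r' -> r = r'.
Proof.
move=> HJ /quot_dimP [b [bU bs bi]] /quot_dimP [b' [bU' bs' bi']].
apply/eqP; rewrite eqn_leq.
have := indep_card_le HJ bs bU' bi'; have := indep_card_le HJ bs' bU bi.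
by rewrite !card_ord => -> ->.
Qed.

Lemma quot_dim_exists U J (T : finType) (b : T -> S) :
  subspace J -> span_mod U J b -> exists r, quot_dim U J r.
Proof.
move=> HJ Hs.
have [||| r [b' Hb']] := @basis_exists _ _ U J #|T| 0 (fun _ => 0) HJ.
- by case.
- by move=> c _ [].
- by move=> t b' HU /(indep_card_le HJ Hs HU); rewrite card_ord.
by exists r; apply/quot_dimP; exists b'.
Qed.

End QuotDim.
(** * Ideals and homogeneous ideals *)

Section IdealTheory.
Variable R : comNzRingType.
Implicit Types (I J : R -> Prop) (s : seq R).

Lemma ideal_sum J (T : Type) (r : seq T) (P : pred T) (F : T -> R) :
  is_ideal J -> (forall i, P i -> J (F i)) -> J (\sum_(i <- r | P i) F i).
Proof. by case=> H0 HD _ HF; elim/big_ind: _. Qed.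

Lemma idealN J f : is_ideal J -> J f -> J (- f).
Proof. by case=> _ _ HM Jf; rewrite -mulN1r; apply: HM. Qed.

Lemma idealB J f g : is_ideal J -> J f -> J g -> J (f - g).
Proof. by move=> HJ Jf Jg; case: (HJ) => _ HD _; apply: HD => //; apply: idealN. Qed.

Lemma ideal_congr J f g : is_ideal J -> J (f - g) -> J f <-> J g.
Proof.
move=> HJ Jfg; split=> H; first by rewrite -[g](subKr f); apply: idealB.
by rewrite -[f](subrK g); case: HJ => _ HD _; apply: HD.
Qed.

Lemma ideal_gen_ideal (F : R -> Prop) : is_ideal (ideal_gen F).
Proof.
split=> [|_ _ [m [a [g [Fg ->]]]] [m' [a' [g' [Fg' ->]]]]|c _ [m [a [g [Fg ->]]]]].
- by exists 0, (fun _ => 0), (fun _ => 0); split; [case|rewrite big_ord0].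
- pose sel T (u : 'I_m -> T) (v : 'I_m' -> T) i :=
    match split i with inl j => u j | inr j => v j end.
  exists (m + m')%N, (sel _ a a'), (sel _ g g'); split.
    by move=> i; rewrite /sel; case: split.
  rewrite big_split_ord /sel; congr (_ + _); apply: eq_bigr => i _.
    by rewrite -/(unsplit (inl i)) unsplitK.
  by rewrite -/(unsplit (inr i)) unsplitK.
- exists m, (fun i => c * a i), g; split=> //.
  by rewrite mulr_sumr; apply: eq_bigr => i _; rewrite mulrA.
Qed.

Lemma ideal_gen_in (F : R -> Prop) f : F f -> ideal_gen F f.
Proof.
move=> Ff; exists 1, (fun _ => 1), (fun _ => f); split=> //.
by rewrite big_ord1 mul1r.
Qed.

Lemma ideal_gen_min (F : R -> Prop) J f :
  is_ideal J -> (forall g, F g -> J g) -> ideal_gen F f -> J f.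
Proof.
move=> HJ HF [m [a [g [Fg ->]]]]; apply: ideal_sum => // i _.
by case: HJ => _ _; apply; apply: HF.
Qed.

Lemma ideal_adjoin_ideal I s : is_ideal (ideal_adjoin I s).
Proof. exact: ideal_gen_ideal. Qed.

Lemma ideal_adjoin_min I s J f : is_ideal J ->
  (forall g, I g -> J g) -> (forall g, g \in s -> J g) -> ideal_adjoin I s f -> J f.
Proof. by move=> HJ HI Hs; apply: ideal_gen_min => // g []; [apply: HI|apply: Hs]. Qed.

Lemma ideal_adjoin_base I s f : I f -> ideal_adjoin I s f.
Proof. by move=> If; apply: ideal_gen_in; left. Qed.

Lemma ideal_adjoin_in I s f : f \in s -> ideal_adjoin I s f.
Proof. by move=> fs; apply: ideal_gen_in; right. Qed.

Lemma ideal_adjoin_nil I f : is_ideal I -> ideal_adjoin I [::] f <-> I f.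
Proof.
by move=> HI; split; [apply: ideal_adjoin_min | apply: ideal_adjoin_base].
Qed.

(** Describes one step of a regular sequence: the ideal grows by the multiples of a. *)
Lemma ideal_adjoin_rcons I s a f :
  ideal_adjoin I (rcons s a) f <-> exists g, ideal_adjoin I s (f - g * a).
Proof.
have [H0 HD HM] := ideal_adjoin_ideal I s.
have [H0' HD' HM'] := ideal_adjoin_ideal I (rcons s a).
split=> [|[g Hg]].
- apply: (ideal_adjoin_min (J := fun f => exists g, ideal_adjoin I s (f - g * a))).
  + split=> [|u v [g Hg] [h Hh]|c u [g Hg]].
    * by exists 0; rewrite mul0r subr0.
    * exists (g + h); have -> : u + v - (g + h) * a = (u - g * a) + (v - h * a) by ring.
      exact: HD.
    * exists (c * g); have -> : c * u - c * g * a = c * (u - g * a) by ring.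
      exact: HM.
  + by move=> g Ig; exists 0; rewrite mul0r subr0; apply: ideal_adjoin_base.
  + move=> g; rewrite mem_rcons inE => /orP [/eqP ->|gs].
      by exists 1; rewrite mul1r subrr.
    by exists 0; rewrite mul0r subr0; apply: ideal_adjoin_in.
- rewrite -[f](subrK (g * a)); apply: HD'; last first.
    by apply: HM'; apply: ideal_adjoin_in; rewrite mem_rcons mem_head.
  apply: ideal_adjoin_min Hg; first exact: ideal_adjoin_ideal.
    by move=> h; apply: ideal_adjoin_base.
  by move=> h hs; apply: ideal_adjoin_in; rewrite mem_rcons inE hs orbT.
Qed.

End IdealTheory.

Section GradedIdeals.
Variables (n : nat) (K : fieldType).
Local Notation S := {mpoly K[n]}.
Implicit Types (I J : S -> Prop) (s : seq S).

Lemma ideal_subspace J : is_ideal J -> subspace J.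
Proof. by case=> H0 HD HM; split=> // a f Jf; rewrite -mul_mpolyC; apply: HM. Qed.

Definition homog_closed J : Prop := forall f d, J f -> J (pihomog mdeg d f).

(** Multiplication by a form of degree e shifts degrees by e; this is what makes ideals
    generated by forms homogeneous. *)
Lemma pihomogMr (a g : S) d e : g \is e.-homog ->
  pihomog mdeg d (a * g) = if (e <= d)%N then pihomog mdeg (d - e) a * g else 0.
Proof.
(* The bound d.+1 makes the component of degree d - e appear in the sum. *)
move=> hg; pose k := maxn (msize a) d.+1.
have ak : (mmeasure mdeg a <= k)%N by rewrite leq_maxl.
rewrite {1}(pihomog_partitionE ak) mulr_suml raddf_sum /=.
have E (i : 'I_k) : pihomog mdeg d (pihomog mdeg i a * g)
    = if (i + e == d)%N then pihomog mdeg i a * g else 0.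
  have hi : pihomog mdeg i a * g \is (i + e).-homog by apply: dhomogM => //; apply: pihomogP.
  by have [<-|ne] := eqVneq; [rewrite pihomog_dE | rewrite (pihomog_ne0 ne)].
under eq_bigr do rewrite E.
rewrite -big_mkcond /=; case: leqP => [led|ltd].
  have dk : (d - e < k)%N by rewrite leq_max; lia.
  rewrite (big_pred1 (Ordinal dk)) // => i /=.
  by rewrite -val_eqE /=; lia.
by rewrite big_pred0 // => i; lia.
Qed.

Lemma ideal_gen_homog (F : S -> Prop) :
  (forall g, F g -> exists d, g \is d.-homog) -> homog_closed (ideal_gen F).
Proof.
move=> HF f d [m [a [g [Fg ->]]]]; rewrite raddf_sum /=.
apply: ideal_sum; first exact: ideal_gen_ideal.
move=> i _; have [e he] := HF _ (Fg i); rewrite (pihomogMr _ _ he).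
have [H0 _ HM] := ideal_gen_ideal F; case: ifP => // _.
by apply: HM; apply: ideal_gen_in.
Qed.

(** The elements all of whose components lie in the enlarged ideal form an ideal containing
    its generators. *)
Lemma ideal_adjoin_homog I s : homog_closed I ->
  (forall g, g \in s -> exists d, g \is d.-homog) -> homog_closed (ideal_adjoin I s).
Proof.
move=> HI Hs f d.
pose J (f : S) := forall d, ideal_adjoin I s (pihomog mdeg d f).
have HJ : is_ideal J.
  have Hid := ideal_adjoin_ideal I s; have [H0 HD HM] := Hid.
  split=> [e|u v Ju Jv e|c u Ju e].
  - by rewrite raddf0.
  - by rewrite raddfD; apply: HD; [apply: Ju|apply: Jv].
  - have uk : (mmeasure mdeg u <= msize u)%N by [].
    rewrite [u in c * u](pihomog_partitionE uk) mulr_sumr raddf_sum /=.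
    apply: ideal_sum => // i _; rewrite (pihomogMr _ _ (pihomogP _ _ _)).
    by case: ifP => // _; apply: HM; apply: Ju.
suff: forall f, ideal_adjoin I s f -> J f by move=> H /H; apply.
move=> g; apply: ideal_adjoin_min => // h Hh e.
  by apply: ideal_adjoin_base; apply: HI.
have [e' he] := Hs _ Hh; have [H0 _ _] := ideal_adjoin_ideal I s.
have [<-|ne] := eqVneq e' e; last by rewrite (pihomog_ne0 ne).
by rewrite pihomog_dE //; apply: ideal_adjoin_in.
Qed.

Lemma mpoly_monomial_ind J (f : S) : subspace J ->
  (forall m, m \in msupp f -> J 'X_[m]) -> J f.
Proof.
move=> HJ Hm; rewrite [f]mpolyE big_seq; apply: subspace_sum => // m /Hm Jm.
by case: HJ => _ _; apply.
Qed.

End GradedIdeals.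
(** * Monomial ideals *)

Section MonomialIdeals.
Variables (n : nat) (K : fieldType).
Local Notation S := {mpoly K[n]}.
Implicit Types (L : pred 'X_{1..n}) (m : 'X_{1..n}).

Definition up_closed L : Prop := forall m m', L m -> L (m + m')%MM.

Definition monomial_ideal L : S -> Prop := fun f => forall m, m \in msupp f -> L m.

Lemma monomial_idealP L f :
  monomial_ideal L f <-> forall m, ~~ L m -> f@_m = 0.
Proof.
split=> H m; first by move=> Lm; apply: memN_msupp_eq0; apply: contra Lm; apply: H.
by rewrite mcoeff_msupp; apply: contra_neqT; apply: H.
Qed.

Lemma monomial_idealX L m : monomial_ideal L 'X_[m] <-> L m.
Proof.
split=> [H|Lm k]; first by apply: H; rewrite msuppX mem_head.
by rewrite msuppX inE => /eqP ->.
Qed.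

Lemma monomial_ideal_subspace L : subspace (monomial_ideal L).
Proof.
split=> [m|f g Hf Hg m|a f Hf m].
- by rewrite msupp0.
- by move/msuppD_le; rewrite mem_cat => /orP [/Hf|/Hg].
- by move/msuppZ_le/Hf.
Qed.

Lemma monomial_ideal_ideal L : up_closed L -> is_ideal (monomial_ideal L).
Proof.
move=> HL; have [H0 HD HZ] := monomial_ideal_subspace L.
split=> // a f Hf; rewrite [a]mpolyE mulr_suml.
apply: subspace_sum => // m _; rewrite -scalerAl; apply: HZ => k.
rewrite mulrC (perm_mem (msuppMX _ _)) => /mapP [k' /Hf Lk' ->].
by rewrite addmC; apply: HL.
Qed.

Lemma monomial_ideal_min L J (f : S) : is_ideal J ->
  (forall m, L m -> exists2 g, (g <= m)%MM & J 'X_[g]) -> monomial_ideal L f -> J f.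
Proof.
move=> HJ HL Hf; apply: mpoly_monomial_ind; first exact: ideal_subspace.
move=> m /Hf /HL [g gm Jg]; rewrite -(submK gm) mpolyXD.
by case: HJ => _ _; apply.
Qed.

Lemma mcoeffMXU (f : S) i m :
  ('X_i * f)@_m = if (0 < m i)%N then f@_(m - U_(i)) else 0.
Proof.
rewrite mulrC; case: ltnP => mi.
  have {1}-> : m = (U_(i) + (m - U_(i)))%MM.
    apply/mnmP => j; rewrite mnmDE mnmBE mnm1E; case: eqVneq => [<-|_] /=; lia.
  exact: mcoeffMX.
apply: memN_msupp_eq0; rewrite (perm_mem (msuppMX _ _)).
by apply/negP => /mapP [k _ E]; move: mi; rewrite E mnmDE mnm1E eqxx.
Qed.

(** If (x_a - x_b) f lies in a monomial ideal, the coefficient of f at a monomial m outside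
    the ideal is read off at m x_a when x_b does not divide m, and at m x_b otherwise: by
    the hypotheses no other monomial of f contributes there. *)
Lemma diff_regular_mod_monomial L a b (f : S) : a != b ->
  (forall m, ~~ L m -> m b = 0%N -> ~~ L (m + U_(a))%MM) ->
  (forall m, ~~ L m -> (0 < m b)%N -> m a = 0%N /\ ~~ L (m + U_(b))%MM) ->
  monomial_ideal L (('X_a - 'X_b) * f) -> monomial_ideal L f.
Proof.
move=> ab Ha Hb /monomial_idealP Hf; apply/monomial_idealP => m Lm.
have [mb|mb] := posnP (m b).
  have := Hf _ (Ha _ Lm mb); rewrite mulrBl mcoeffB !mcoeffMXU !mnmDE !mnm1E eqxx.
  by rewrite mb (negbTE ab) addn1 /= subr0 addmK.
have [ma Lmb] := Hb _ Lm mb.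
have := Hf _ Lmb; rewrite mulrBl mcoeffB !mcoeffMXU !mnmDE !mnm1E eqxx.
by rewrite ma eq_sym (negbTE ab) addn1 /= sub0r addmK => /eqP; rewrite oppr_eq0 => /eqP.
Qed.

Definition zero_set m : {set 'I_n} := [set k | m k == 0%N].

(** A monomial lies in the complementary edge ideal exactly when its zero set satisfies this
    predicate. *)
Definition edge_covered (e : rel 'I_n) (Z : {set 'I_n}) : bool :=
  [exists i, exists j, e i j && (Z \subset [set i; j])].

Lemma edge_coveredP (e : rel 'I_n) (Z : {set 'I_n}) :
  reflect (exists i j, e i j /\ Z \subset [set i; j]) (edge_covered e Z).
Proof.
apply: (iffP existsP) => [[i /existsP [j /andP [eij Zij]]]|[i [j [eij Zij]]]].
  by exists i, j.
by exists i; apply/existsP; exists j; rewrite eij.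
Qed.

Lemma edge_covered_up (e : rel 'I_n) : up_closed (fun m => edge_covered e (zero_set m)).
Proof.
move=> m m' /edge_coveredP [i [j [eij Zij]]]; apply/edge_coveredP; exists i, j; split=> //.
apply: subset_trans Zij; apply/subsetP => k.
by rewrite !inE mnmDE addn_eq0 => /andP [].
Qed.

Lemma prod_complementE (i j : 'I_n) :
  \prod_(k | (k != i) && (k != j)) 'X_k =
    'X_[[multinom ((k != i) && (k != j) : nat) | k < n]] :> S.
Proof.
rewrite mpolyXE_id big_mkcond /=; apply: eq_bigr => k _.
by rewrite mnmE; case: ifP; rewrite ?expr1 ?expr0.
Qed.

Lemma complementary_edge_idealE (e : rel 'I_n) (f : S) :
  complementary_edge_ideal e f <-> monomial_ideal (fun m => edge_covered e (zero_set m)) f.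
Proof.
split.
  apply: ideal_gen_min; first exact/monomial_ideal_ideal/edge_covered_up.
  move=> _ [i [j [eij ->]]]; rewrite prod_complementE; apply/monomial_idealX.
  apply/edge_coveredP; exists i, j; split=> //; apply/subsetP => k.
  by rewrite !inE mnmE; case: (k == i); case: (k == j).
apply: monomial_ideal_min; first exact: ideal_gen_ideal.
move=> m /edge_coveredP [i [j [eij /subsetP Zij]]].
exists [multinom ((k != i) && (k != j) : nat) | k < n]; last first.
  by apply: ideal_gen_in; exists i, j; rewrite prod_complementE.
apply/mnm_lepP => k; rewrite mnmE; case E: (_ && _) => //=.
rewrite lt0n; apply/negP => mk0; have := Zij k; rewrite !inE mk0 => /(_ isT).
by move: E => /andP [/negbTE -> /negbTE ->].
Qed.

(** Monomials with exponents below N, indexed by a finite type in order to be counted. *)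
Definition ffun_mnm N (m : {ffun 'I_n -> 'I_N}) : 'X_{1..n} := [multinom (m i : nat) | i < n].

Lemma ffun_mnm_inj N : injective (@ffun_mnm N).
Proof.
move=> t u E; apply/ffunP => i; apply/val_inj.
by have := congr1 (fun m : 'X_{1..n} => m i) E; rewrite !mnmE.
Qed.

Lemma ffun_mnm_onto N m : (forall i, m i < N)%N -> exists m' : {ffun 'I_n -> 'I_N}, ffun_mnm m' = m.
Proof.
by move=> lt; exists [ffun i => Ordinal (lt i)]; apply/mnmP => i; rewrite mnmE ffunE.
Qed.

Lemma mcoeff_box_sum N (Q : pred {ffun 'I_n -> 'I_N}) (c : {m | Q m} -> K) t :
  (\sum_u c u *: 'X_[K, ffun_mnm (val u)])@_(ffun_mnm (val t)) = c t.
Proof.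
rewrite raddf_sum /= (bigD1 t) //= mcoeffZ mcoeffX eqxx mulr1 big1 ?addr0 // => u ut.
by rewrite mcoeffZ mcoeffX (inj_eq (@ffun_mnm_inj N)) val_eqE (negbTE ut) mulr0.
Qed.

Lemma msupp_sub_box_sum N (Q : pred {ffun 'I_n -> 'I_N}) (f : S) m :
  m \in msupp (f - \sum_(u : {m | Q m}) f@_(ffun_mnm (val u)) *: 'X_[K, ffun_mnm (val u)]) ->
  m \in msupp f /\ forall m' : {ffun 'I_n -> 'I_N}, ffun_mnm m' = m -> ~~ Q m'.
Proof.
rewrite mcoeff_msupp mcoeffB => nz; split; last first.
  move=> m' E; apply/negP => Qm'; move: nz.
  by rewrite -E (mcoeff_box_sum (fun u => f@_(ffun_mnm (val u))) (exist _ m' Qm')) subrr eqxx.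
rewrite mcoeff_msupp; apply: contraNneq nz => fm; rewrite fm sub0r raddf_sum /= big1 ?oppr0 //.
move=> u _; rewrite mcoeffZ mcoeffX; case: eqP => [->|_]; last by rewrite mulr0.
by rewrite fm mul0r.
Qed.

End MonomialIdeals.

(** * Hilbert functions and regular sequences *)

Section HilbertFunction.
Variables (n : nat) (K : fieldType).
Local Notation S := {mpoly K[n]}.
Implicit Types (I J : S -> Prop) (s : seq S).

Definition hilb J (k r : nat) : Prop := quot_dim (fun f : S => f \is k.-homog) J r.

(** The monomials of degree k outside a monomial ideal are a basis of the degree k part of
    the quotient. *)
Lemma hilb_monomial (L : pred 'X_{1..n}) N k : (k < N)%N ->
  hilb (monomial_ideal L) k
    #|[pred m : {ffun 'I_n -> 'I_N} | ((\sum_i m i)%N == k) && ~~ L (ffun_mnm m)]|.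
Proof.
move=> kN; set P := [pred m | _].
have degmon (m : {ffun 'I_n -> 'I_N}) : mdeg (ffun_mnm m) = (\sum_i m i)%N.
  by rewrite mdegE; apply: eq_bigr => i _; rewrite mnmE.
rewrite -card_sig; apply: (quot_dim_basis (b := fun t : {m | P m} => 'X_[ffun_mnm (val t)])).
- by move=> t /=; rewrite dhomogX /= degmon; case/andP: (valP t).
- move=> f hf; exists (fun t => f@_(ffun_mnm (val t))) => m /msupp_sub_box_sum [mf Hm].
  have dm : mdeg m = k by move/dhomogP: hf; apply.
  have [i|m' E] := @ffun_mnm_onto n N m.
    by apply: leq_ltn_trans kN; rewrite -dm mdegE (bigD1 i) //= leq_addr.
  by move: (Hm _ E); rewrite /P /= -degmon E dm eqxx negbK.
- move=> c /monomial_idealP Hc t; rewrite -(mcoeff_box_sum c t); apply: Hc.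
  by have /andP [] := valP t.
Qed.

(** The degree k - d part of S, which multiplication by a form of degree d maps to degree k;
    it must be zero, and not S_0, when k < d. *)
Definition shift_part k d : S -> Prop :=
  fun f => if (d <= k)%N then (f \is (k - d).-homog : Prop) else f = 0.

(** Exactness of 0 -> (S/J)(-d) -> S/J -> S/(J + a) -> 0 in degree k: the multiples by a of
    a basis on the left together with lifts of a basis on the right form a basis in the
    middle. *)
Lemma hilb_regular_step J J' a d k r r1 :
  is_ideal J -> homog_closed J -> a \is d.-homog ->
  (forall f, J (a * f) -> J f) -> is_ideal J' ->
  (forall f, J' f <-> exists g, J (f - g * a)) ->
  hilb J k r -> quot_dim (shift_part k d) J r1 ->
  exists2 r2, hilb J' k r2 & r = (r1 + r2)%N.
Proof.
move=> HJ hJ ha reg HJ' J'E hr hr1.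
have [J0 JD JM] := HJ; have sJ := ideal_subspace HJ.
have JJ' f : J f -> J' f by move=> Jf; apply/J'E; exists 0; rewrite mul0r subr0.
have [r2 hr2] : exists r2, hilb J' k r2.
  have /quot_dimP [b [_ bs _]] := hr.
  apply: (quot_dim_exists (b := b)); first exact: ideal_subspace.
  by move=> f /bs [c Hc]; exists c; apply: JJ'.
exists r2 => //; apply: (quot_dim_uniq sJ hr).
have /quot_dimP [b [bU bs bi]] := hr1; have /quot_dimP [c [cU cs ci]] := hr2.
have -> : (r1 + r2)%N = #|{: 'I_r1 + 'I_r2}| by rewrite card_sum !card_ord.
have shiftM g : shift_part k d g -> g * a \is k.-homog.
  rewrite /shift_part; case: leqP => [dk hg|_ ->]; last by rewrite mul0r dhomog0.
  by rewrite -[in k.-homog](subnK dk); apply: dhomogM.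
have shiftP f g : f \is k.-homog -> J (f - g * a) ->
    exists2 g', shift_part k d g' & J (f - g' * a).
  move=> hf /(hJ _ k); rewrite raddfB /= (pihomog_dE hf) (pihomogMr _ _ ha) /shift_part.
  case: leqP => _ H; last by exists 0; rewrite ?mul0r.
  by exists (pihomog mdeg (k - d) g) => //; apply: pihomogP.
apply: (quot_dim_basis (b := fun t => match t with inl i => b i * a | inr j => c j end)).
- by case=> i; [apply/shiftM/bU | apply: cU].
- move=> f hf; have [v Hv] := cs f hf.
  move/J'E: Hv => [g]; case/shiftP.
    by apply: rpredB => //; apply: rpred_sum => j _; apply/rpredZ/cU.
  move=> g' /bs [u Hu] Hg.
  exists (fun t => match t with inl i => u i | inr j => v j end).
  rewrite big_sumType /=.
  under eq_bigr do rewrite scalerAl; rewrite -mulr_suml.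
  set A := \sum_i u i *: b i in Hu *; set B := \sum_j _ in Hg *.
  have -> : f - (A * a + B) = (f - B - g' * a) + a * (g' - A) by ring.
  by apply: JD => //; apply: JM.
- move=> u; rewrite big_sumType /=.
  under eq_bigr do rewrite scalerAl; rewrite -mulr_suml => Hu.
  have Hr : forall j, u (inr j) = 0.
    apply: ci; apply/J'E; exists (- \sum_i u (inl i) *: b i).
    by rewrite mulNr opprK addrC.
  move: Hu; rewrite [X in _ + X]big1 ?addr0 => [|j _]; last by rewrite Hr scale0r.
  by rewrite mulrC => /reg /bi Hl [].
Qed.

(** p agrees with the Hilbert series of S/J up to degree N - 1.  Series are handled through
    all their truncations. *)
Definition hilb_below J N (p : {poly rat}) : Prop :=
  forall k, (k < N)%N -> exists2 r, hilb J k r & p`_k = r%:R.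

Lemma hilb_below_step J J' a d N p :
  is_ideal J -> homog_closed J -> a \is d.-homog ->
  (forall f, J (a * f) -> J f) -> is_ideal J' ->
  (forall f, J' f <-> exists g, J (f - g * a)) ->
  hilb_below J N p -> hilb_below J' N (p * (1 - 'X^d)).
Proof.
move=> HJ hJ ha reg HJ' J'E Hp k kN; have [r hr pk] := Hp k kN.
have [r1 hr1 pk1] : exists2 r1, quot_dim (shift_part k d) J r1 &
    (if (d <= k)%N then p`_(k - d) else 0) = r1%:R.
  rewrite /shift_part; case: leqP => dk.
    by have [|r1 ? ?] := Hp (k - d)%N; [lia | exists r1].
  exists 0 => //; apply/quot_dimP; exists (fun=> 0); split=> // [f ->|c _ []//].
  by exists (fun=> 0); rewrite big_ord0 subrr; case: HJ.
have [r2 hr2 E] := hilb_regular_step HJ hJ ha reg HJ' J'E hr hr1.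
exists r2 => //; rewrite mulrBr mulr1 coefB coefMXn pk.
by move: pk1; rewrite ltnNge; case: leqP => _ /= ->; rewrite E natrD addrC addKr.
Qed.

Lemma hilb_below_regular_seq I s (ds : seq nat) N p :
  is_ideal I -> homog_closed I -> regular_seq I s -> size ds = size s ->
  (forall i, (i < size s)%N -> s`_i \is (nth 0%N ds i).-homog) ->
  hilb_below I N p ->
  hilb_below (ideal_adjoin I s) N (p * \prod_(d <- ds) (1 - 'X^d)).
Proof.
move=> HI hI [_ reg] sds hs Hp.
suff H i : (i <= size s)%N -> hilb_below (ideal_adjoin I (take i s)) N
    (p * \prod_(d <- take i ds) (1 - 'X^d)).
  by have := H _ (leqnn _); rewrite take_size -sds take_size.
elim: i => [_|i IH lti].
  rewrite !take0 big_nil mulr1 => k /Hp [r hr pk]; exists r => //.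
  have /quot_dimP [b [bU bs bi]] := hr.
  apply/quot_dimP; exists b; split=> //.
    by move=> f /bs [c Hc]; exists c; apply/ideal_adjoin_nil.
  by move=> c /(ideal_adjoin_nil _ HI) /bi.
have ltd : (i < size ds)%N by rewrite sds.
rewrite (take_nth 0 lti) (take_nth 0%N ltd) -(cats1 (take i ds)) big_cat big_seq1 /= mulrA.
apply: (hilb_below_step (J := ideal_adjoin I (take i s)) (a := s`_i)).
- exact: ideal_adjoin_ideal.
- apply: ideal_adjoin_homog => // g /(nthP 0) [j]; rewrite size_take lti => ltj <-.
  by rewrite nth_take //; exists (nth 0%N ds j); apply: hs; apply: ltn_trans lti.
- exact: hs.
- exact: reg.
- exact: ideal_adjoin_ideal.
- by move=> f; apply: ideal_adjoin_rcons.
- by apply: IH; apply: ltnW.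
Qed.

End HilbertFunction.
(** * Duality for a one-dimensional socle *)

Section Duality.
Variables (n : nat) (K : fieldType).
Local Notation S := {mpoly K[n]}.
Variable J : S -> Prop.
Hypotheses (HJ : is_ideal J) (hJ : homog_closed J).

Lemma homog_degreeS_in k :
  (forall f : S, f \is k.-homog -> J f) -> forall f : S, f \is k.+1.-homog -> J f.
Proof.
move=> Hk f /dhomogP hf; apply: mpoly_monomial_ind; first exact: ideal_subspace.
move=> m /hf dm; have [i mi] : exists i, m i != 0%N.
  apply/existsP; apply: contra_eqT dm; rewrite negb_exists => /forallP m0 /=.
  by rewrite mdegE big1 // => i _; have := m0 i; rewrite negbK => /eqP.
have E : m = (U_(i) + (m - U_(i)))%MM.
  by apply/mnmP => j; rewrite mnmDE mnmBE mnm1E; case: eqVneq => [<-|_] /=; lia.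
rewrite E mpolyXD; case: HJ => _ _; apply; apply: Hk; rewrite dhomogX /=.
by move: dm; rewrite /= {1}E mdegD mdeg1 add1n => -[->].
Qed.

Lemma homog_degree_le_in k l :
  (k <= l)%N -> (forall f : S, f \is k.-homog -> J f) -> forall f : S, f \is l.-homog -> J f.
Proof.
move=> /subnK <-; elim: (l - k)%N => // d IH Hk; rewrite addSn.
by apply: homog_degreeS_in; apply: IH.
Qed.

(** If none of the degrees 0, ..., r were contained in J, elements outside J of these
    degrees would be r + 1 independent elements modulo J. *)
Lemma finite_quotient_top r : quot_dim (fun=> True) J r ->
  forall f : S, f \is r.-homog -> J f.
Proof.
move=> /quot_dimP [b [_ bs _]].
have [k kr Hk] : exists2 k, (k <= r)%N & forall f : S, f \is k.-homog -> J f.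
  apply: NNPP => Hno.
  have Hex (k : 'I_r.+1) : exists f : S, f \is k.-homog /\ ~ J f.
    apply: NNPP => Hk; apply: Hno; exists k; first by rewrite -ltnS.
    by move=> f hf; apply: NNPP => Jf; apply: Hk; exists f.
  have [F HF] := fin_all_exists Hex.
  have Fi : indep_mod J F.
    move=> c /hJ Hc k; have := Hc k; rewrite raddf_sum /= (bigD1 k) //= big1 => [|j jk].
      rewrite addr0 linearZ /= pihomog_dE; last by case: (HF k).
      have [->//|ck] := eqVneq (c k) 0; case: (HF k) => _ NJ Jc; case: NJ.
      by rewrite -[F k](scalerK ck); case: (ideal_subspace HJ) => _ _; apply.
    rewrite linearZ /= (@pihomog_ne0 _ _ _ j) ?scaler0 //.
    by case: (HF j).
  have := indep_card_le (ideal_subspace HJ) bs (fun=> I) Fi.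
  by rewrite !card_ord ltnn.
exact: homog_degree_le_in Hk.
Qed.

Hypothesis finite_quotient : exists r, quot_dim (fun=> True) J r.

(** Multiplying by variables raises the degree and every form of large degree lies in J: the
    last multiple outside J is in the socle modulo J. *)
Lemma socle_multiple k (f : S) : f \is k.-homog -> ~ J f ->
  exists l (g : S), [/\ g \is l.-homog, ~ J (f * g) & colon_max J (f * g)].
Proof.
have [r Hr] := finite_quotient; have Htop := finite_quotient_top Hr.
move=> hf Nf.
have kr : (k <= r)%N.
  rewrite leqNgt; apply/negP => rk; apply: Nf.
  exact: (homog_degree_le_in (ltnW rk) Htop).
have [d] := ubnP (r - k); elim: d k f hf Nf kr => // d IH k f hf Nf kr; rewrite ltnS => led.
have [soc|/not_all_ex_not [i Ni]] := classic (colon_max J f).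
  by exists 0%N, 1; rewrite mulr1; split=> //; apply: dhomog1.
have hXf : 'X_i * f \is k.+1.-homog.
  by rewrite -add1n; apply: dhomogM => //; rewrite dhomogX /= mdeg1.
have k1r : (k < r)%N.
  rewrite ltn_neqAle kr andbT; apply/eqP => E; subst k; apply: Ni.
  by case: HJ => _ _; apply; apply: Htop.
have [|l [g [hg Ng sg]]] := IH k.+1 _ hXf Ni k1r; first by lia.
exists l.+1, ('X_i * g); rewrite mulrCA mulrA; split=> //.
by rewrite -add1n; apply: dhomogM => //; rewrite dhomogX /= mdeg1.
Qed.

Hypothesis socle_dim1 : quot_dim (colon_max J) J 1.

Lemma socle_proportional (f g : S) : colon_max J f -> ~ J f -> colon_max J g ->
  exists c : K, J (g - c *: f).
Proof.
have [b [_ bs _]] := socle_dim1; have [J0 JD JZ] := ideal_subspace HJ.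
move=> /bs [u]; rewrite big_ord1 => Hu Nf /bs [v]; rewrite big_ord1 => Hv.
have u0 : u ord0 != 0.
  apply/eqP => E; apply: Nf; move: Hu.
  by rewrite E scale0r subr0.
exists (v ord0 / u ord0).
have -> : g - (v ord0 / u ord0) *: f
    = (g - v ord0 *: b ord0) - (v ord0 / u ord0) *: (f - u ord0 *: b ord0).
  rewrite scalerBr scalerA mulfVK // opprB addrACA [- _ + _]addrC; ring.
by apply: idealB => //; apply: JZ.
Qed.

(** Homogeneous socle elements are proportional modulo J, and J is homogeneous. *)
Lemma socle_degree_uniq k l (f g : S) : f \is k.-homog -> g \is l.-homog ->
  colon_max J f -> ~ J f -> colon_max J g -> ~ J g -> k = l.
Proof.
move=> hf hg sf Nf sg Ng; have [c Jc] := socle_proportional sf Nf sg.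
apply/eqP/negPn/negP => kl; apply: Ng.
have := hJ l Jc; rewrite raddfB /= linearZ /= (pihomog_dE hg).
by rewrite (pihomog_ne0 kl hf) scaler0 subr0.
Qed.

Hypothesis J_proper : ~ J 1.

(** With w spanning the socle, in degree s, every form f outside J has a multiple f g
    outside J in the socle, so g has degree s - deg f.  Hence A_k x A_l -> K w is
    nondegenerate whenever k + l = s, and a kernel vector of its matrix would be a relation
    between basis elements. *)
Lemma hilb_symmetric : exists s,
  (forall k r, (s < k)%N -> hilb J k r -> r = 0%N) /\
  (forall k l r r', (k + l)%N = s -> hilb J k r -> hilb J l r' -> r = r').
Proof.
have sJ := ideal_subspace HJ.
have [s [w [hw Nw sw]]] := socle_multiple (dhomog1 _ _) J_proper.
rewrite mul1r in Nw sw.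
(* The pairing is nondegenerate: the socle multiple of f has degree s. *)
have perf k (f : S) : f \is k.-homog -> ~ J f ->
    exists l g, [/\ (k + l = s)%N, g \is l.-homog & ~ J (f * g)].
  move=> hf Nf; have [l [g [hg Ng sg]]] := socle_multiple hf Nf.
  by exists l, g; split=> //; apply: (socle_degree_uniq _ hw sg) => //; apply: dhomogM.
have top k (f : S) : (s < k)%N -> f \is k.-homog -> J f.
  move=> sk hf; apply: NNPP => /(perf _ _ hf) [l [g [E _ _]]]; lia.
have prop (f : S) : f \is s.-homog -> exists c : K, J (f - c *: w).
  move=> hf; apply: socle_proportional => // i; apply: (top s.+1) => //.
  by rewrite -add1n; apply: dhomogM => //; rewrite dhomogX /= mdeg1.
exists s; split.
  move=> k [//|r] sk /quot_dimP [b [bU _ bi]].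
  have Jb : J (\sum_i 1 *: b i).
    by apply: subspace_sum => // i _; case: sJ => _ _; apply; apply: (top k).
  by have /eqP := bi (fun=> 1) Jb ord0; rewrite oner_eq0.
have le k l r r' : (k + l)%N = s -> hilb J k r -> hilb J l r' -> (r <= r')%N.
  move=> kl /quot_dimP [b [bU bs bi]] /quot_dimP [c [cU cs ci]].
  have Hbc i j : exists a : K, J (b i * c j - a *: w).
    by apply: prop; rewrite -kl; apply: dhomogM; [apply: bU | apply: cU].
  have [M HM] := fin_all_exists (fun i => fin_all_exists (Hbc i)).
  rewrite leqNgt; apply/negP => rr'.
  have [|v [i0 vi0] Hv] := @left_kernel_exists K 'I_r 'I_r' M; first by rewrite !card_ord.
  move/eqP: vi0; apply; apply: bi.
  set f := \sum_t _.
  have hf : f \is k.-homog by apply: rpred_sum => i _; apply/rpredZ/bU.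
  have fc j : J (f * c j).
    have -> : f * c j = \sum_i v i *: (b i * c j - M i j *: w).
      under [RHS]eq_bigr do rewrite scalerBr scalerA.
      rewrite sumrB -scaler_suml Hv scale0r subr0 mulr_suml.
      by apply: eq_bigr => i _; rewrite scalerAl.
    by apply: subspace_sum => // i _; case: sJ => _ _; apply.
  apply: NNPP => /(perf _ _ hf) [l' [g [E hg Ng]]]; apply: Ng.
  have El : l' = l by lia.
  rewrite El in hg; have [u Hu] := cs g hg.
  apply/(ideal_congr (g := f * \sum_j u j *: c j) HJ).
    by rewrite -mulrBr; case: HJ => _ _; apply.
  rewrite mulr_sumr; apply: subspace_sum => // j _; rewrite -scalerAr.
  by case: sJ => _ _; apply.
move=> k l r r' kl hr hr'; apply/eqP; rewrite eqn_leq (le k l) //=.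
by apply: (le l k) => //; rewrite addnC.
Qed.

End Duality.
(** * The Hilbert series of the complementary edge ideal *)

Section TruncatedCongruence.
Variable R : comNzRingType.
Implicit Types p q : {poly R}.

Definition eq_below N p q : Prop := exists r, p = q + r * 'X^N.

Lemma eq_below_refl N p : eq_below N p p.
Proof. by exists 0; rewrite mul0r addr0. Qed.

Lemma eq_below_mul N p p' q q' :
  eq_below N p q -> eq_below N p' q' -> eq_below N (p * p') (q * q').
Proof.
by move=> [r ->] [r' ->]; exists (r * q' + q * r' + r * r' * 'X^N); ring.
Qed.

Lemma eq_below_sub N p p' q q' :
  eq_below N p q -> eq_below N p' q' -> eq_below N (p - p') (q - q').
Proof. by move=> [r ->] [r' ->]; exists (r - r'); ring. Qed.

Lemma eq_below_sum N (I : Type) (s : seq I) (P : pred I) (F G : I -> {poly R}) :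
  (forall i, P i -> eq_below N (F i) (G i)) ->
  eq_below N (\sum_(i <- s | P i) F i) (\sum_(i <- s | P i) G i).
Proof.
move=> H; elim/big_rec2: _ => [|i p q Pi [r ->]]; first exact: eq_below_refl.
by have [r' ->] := H i Pi; exists (r + r'); ring.
Qed.

Lemma eq_below_prod N (I : Type) (s : seq I) (P : pred I) (F G : I -> {poly R}) :
  (forall i, P i -> eq_below N (F i) (G i)) ->
  eq_below N (\prod_(i <- s | P i) F i) (\prod_(i <- s | P i) G i).
Proof.
move=> H; elim/big_rec2: _ => [|i p q Pi Hpq]; first exact: eq_below_refl.
exact/eq_below_mul/Hpq/H.
Qed.

Lemma eq_below_coef N p q k : eq_below N p q -> (k < N)%N -> p`_k = q`_k.
Proof. by move=> [r ->] kN; rewrite coefD coefMXn kN addr0. Qed.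

Lemma eq_below_of_coef N p q : (forall k, (k < N)%N -> p`_k = q`_k) -> eq_below N p q.
Proof.
move=> H; exists (\poly_(i < size (p - q)) (p - q)`_(N + i)).
apply/polyP => k; rewrite coefD coefMXn; case: ltnP => kN; first by rewrite addr0 H.
rewrite coef_poly subnKC //; case: ltnP => lek; first by rewrite coefB addrC subrK.
apply/eqP; rewrite addr0 -subr_eq0 -coefB; apply/eqP/nth_default.
by apply: leq_trans lek _; apply: leq_subr.
Qed.

Lemma eq_below_all p q : (forall N, eq_below N p q) -> p = q.
Proof. by move=> H; apply/polyP => k; apply: eq_below_coef (H k.+1) _. Qed.

End TruncatedCongruence.

Section CountingMonomials.
Variables (n : nat) (e : rel 'I_n).
Local Notation P := {poly rat}.

Definition num_edges : nat := #|[pred Z : {set 'I_n} | edge_covered e Z && (#|Z| == 2)]|.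

(** The three summands come from the zero sets of size 0, 1 and 2. *)
Definition hilb_numerator (mu : nat) : P :=
  1 - ('X^n + (1 - 'X) * 'X^(n - 1) *+ n + (1 - 'X) ^+ 2 * 'X^(n - 2) *+ mu).

Definition deg_gen N (Q : pred {ffun 'I_n -> 'I_N}) : P :=
  \sum_(m | Q m) 'X^(\sum_i m i)%N.

Lemma coef_deg_gen N (Q : pred {ffun 'I_n -> 'I_N}) k :
  (deg_gen Q)`_k = #|[pred m : {ffun 'I_n -> 'I_N} | ((\sum_i m i)%N == k) && Q m]|%:R.
Proof.
rewrite /deg_gen coef_sum -sum1_card natr_sum /=.
under eq_bigr do rewrite coefXn eq_sym.
rewrite [RHS](eq_bigl (fun m => Q m && ((\sum_i m i)%N == k))) => [|m]; last first.
  by rewrite !inE andbC.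
by rewrite big_mkcondr /=; apply: eq_bigr => m _; case: eqP.
Qed.

Definition ffun_zeros N (m : {ffun 'I_n -> 'I_N}) : {set 'I_n} := [set i | m i == 0%N :> nat].

(** Choosing a monomial with zero set Z means choosing each exponent independently, zero on
    Z and positive off Z. *)
Lemma deg_gen_zeros N (Z : {set 'I_n}) :
  deg_gen (fun m : {ffun 'I_n -> 'I_N} => ffun_zeros m == Z) =
    \prod_i \sum_(j < N | (i \in Z) == (j == 0%N :> nat)) 'X^j.
Proof.
rewrite bigA_distr_big_dep /deg_gen /=; apply: eq_big => [m|m _]; last first.
  by rewrite expr_sum.
apply/eqP/familyP => [<- i|H]; first by rewrite unfold_in /= inE.
by apply/setP => i; rewrite inE; have := H i; rewrite unfold_in /= => /eqP.
Qed.

Lemma geometric_zero_part N (b : bool) :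
  eq_below N.+1 ((1 - 'X) * \sum_(j < N.+1 | b == (j == 0%N :> nat)) 'X^j)
    (if b then 1 - 'X else 'X : P).
Proof.
case: b; first by rewrite (big_pred1 ord0) // expr0 mulr1; apply: eq_below_refl.
(* X + ... + X^N times 1 - X is X - X^(N+1). *)
exists (-1); rewrite (eq_bigl (fun j : 'I_N.+1 => j != ord0)) => [|j]; last first.
  rewrite -val_eqE /=; by case: (val j).
pose T : P := \sum_(j < N.+1 | j != ord0) 'X^j; rewrite -/T.
have E : 'X^(N.+1) - 1 = ('X - 1) * (1 + T) by rewrite subrX1 (bigD1 ord0) //= expr0.
have -> : (1 - 'X) * T = - (('X - 1) * (1 + T)) + ('X - 1) by ring.
by rewrite -E; ring.
Qed.

(** Times 1 - X, an exponent fixed to 0 contributes 1 - X and a positive exponent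
    contributes X + X^2 + ... truncated, that is X. *)
Lemma deg_gen_zeros_below N (Z : {set 'I_n}) :
  eq_below N.+1 ((1 - 'X) ^+ n * deg_gen (fun m : {ffun 'I_n -> 'I_N.+1} => ffun_zeros m == Z))
    ((1 - 'X) ^+ #|Z| * 'X^(n - #|Z|)).
Proof.
have -> : (1 - 'X : P) ^+ n = \prod_(i < n) (1 - 'X) by rewrite prodr_const card_ord.
rewrite deg_gen_zeros -big_split /=.
have -> : (1 - 'X) ^+ #|Z| * 'X^(n - #|Z|) = \prod_(i < n) (if i \in Z then 1 - 'X else 'X : P).
  rewrite (bigID (mem Z)) /=; congr (_ * _).
    by rewrite -prodr_const; apply: eq_bigr => i ->.
  have -> : (n - #|Z| = #|~: Z|)%N by rewrite [#|~: Z|]cardsCs setCK card_ord.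
  by rewrite -prodr_const; apply: eq_big => [i|i]; rewrite !inE // => /negbTE ->.
by apply: eq_below_prod => i _; apply: geometric_zero_part.
Qed.

Lemma deg_gen_all_below N :
  eq_below N.+1 ((1 - 'X) ^+ n * deg_gen (fun _ : {ffun 'I_n -> 'I_N.+1} => true)) 1.
Proof.
have -> : (1 - 'X : P) ^+ n = \prod_(i < n) (1 - 'X) by rewrite prodr_const card_ord.
have -> : deg_gen (fun _ : {ffun 'I_n -> 'I_N.+1} => true) =
    \prod_(i < n) \sum_(j < N.+1) 'X^j.
  by rewrite bigA_distr_bigA; apply: eq_bigr => m _; rewrite expr_sum.
rewrite -big_split /= -[X in eq_below _ _ X](big1_eq (op := *%R) (index_enum 'I_n) predT).
apply: eq_below_prod => i _; exists (-1).
by rewrite -opprB mulNr -subrX1; ring.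
Qed.

Lemma card_edge_covered (Z : {set 'I_n}) : edge_covered e Z -> (#|Z| <= 2)%N.
Proof.
move=> /edge_coveredP [i [j [_ /subset_leq_card le]]].
by apply: leq_trans le _; rewrite cards2; case: (_ != _).
Qed.

(** Without isolated vertices the sets covered by an edge are the empty set, all singletons
    and the edges. *)
Lemma sum_edge_covered : (0 < n)%N -> no_isolated_vertex e ->
  \sum_(Z : {set 'I_n} | edge_covered e Z) ((1 - 'X) ^+ #|Z| * 'X^(n - #|Z|)) =
    'X^n + (1 - 'X) * 'X^(n - 1) *+ n + (1 - 'X) ^+ 2 * 'X^(n - 2) *+ num_edges :> P.
Proof.
move=> n0 hiso.
have slice k : \sum_(Z : {set 'I_n} | edge_covered e Z && (#|Z| == k))
      ((1 - 'X) ^+ #|Z| * 'X^(n - #|Z|) : P) =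
    (1 - 'X) ^+ k * 'X^(n - k) *+ #|[pred Z : {set 'I_n} | edge_covered e Z && (#|Z| == k)]|.
  by rewrite -sumr_const; apply: eq_bigr => Z /andP [_ /eqP ->].
have cov1 (i : 'I_n) : edge_covered e [set i].
  have [j eij] := hiso i; apply/edge_coveredP; exists i, j; split=> //.
  by rewrite sub1set !inE eqxx.
have cov0 : edge_covered e set0.
  have [j eij] := hiso (Ordinal n0); apply/edge_coveredP; exists (Ordinal n0), j.
  by split=> //; apply: sub0set.
have small k : (k < 2)%N ->
    #|[pred Z : {set 'I_n} | edge_covered e Z && (#|Z| == k)]| = 'C(n, k).
  move=> k2; rewrite -[n in 'C(n, _)]card_ord -card_draws; apply: eq_card => Z.
  rewrite !inE; case: eqP => [Zk|]; last by rewrite andbF.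
  rewrite andbT; move: Zk k2; case: k => [|[|//]] /eqP; first by rewrite cards_eq0 => /eqP ->.
  by move/cards1P => [i ->] _; apply: cov1.
rewrite (bigID (fun Z : {set 'I_n} => #|Z| == 0%N)) /= slice small // bin0 mulr1n.
rewrite expr0 mul1r subn0 -addrA; congr (_ + _).
rewrite (bigID (fun Z : {set 'I_n} => #|Z| == 1%N)) /=; congr (_ + _).
  have := slice 1%N; rewrite small // bin1 expr1 => <-.
  by apply: eq_bigl => Z; case: (edge_covered e Z) => //=; case: #|Z| => [|[|k]].
rewrite /num_edges -slice; apply: eq_bigl => Z.
case cZ: (edge_covered e Z) => //=; have := card_edge_covered cZ.
by case: #|Z| => [|[|[|k]]].
Qed.

Lemma deg_gen_uncovered_below N : (0 < n)%N -> no_isolated_vertex e ->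
  eq_below N.+1
    ((1 - 'X) ^+ n *
     deg_gen (fun m : {ffun 'I_n -> 'I_N.+1} => ~~ edge_covered e (ffun_zeros m)))
    (hilb_numerator num_edges).
Proof.
move=> n0 hiso; rewrite /hilb_numerator -sum_edge_covered //.
have -> : deg_gen (fun m : {ffun 'I_n -> 'I_N.+1} => ~~ edge_covered e (ffun_zeros m)) =
    deg_gen (fun _ : {ffun 'I_n -> 'I_N.+1} => true) -
    \sum_(Z | edge_covered e Z) deg_gen (fun m : {ffun 'I_n -> 'I_N.+1} => ffun_zeros m == Z).
  rewrite /deg_gen [\sum_(m | true) _](bigID (fun m => edge_covered e (ffun_zeros m))) /=.
  rewrite [X in _ = X + _ - _](partition_big (@ffun_zeros _) (edge_covered e)) //=.
  rewrite addrAC -[LHS]add0r; congr (_ + _); apply/esym/eqP; rewrite subr_eq0; apply/eqP.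
  apply: eq_bigr => Z cZ.
  by apply: eq_bigl => m; case: eqP => [->|]; rewrite ?cZ ?andbF.
rewrite mulrBr; apply: eq_below_sub; first exact: deg_gen_all_below.
by rewrite mulr_sumr; apply: eq_below_sum => Z _; apply: deg_gen_zeros_below.
Qed.

End CountingMonomials.
(** * Symmetry of the numerator *)

Section PalindromicNumerator.
Implicit Types (p q F : {poly rat}).

(** Reversal involves 1/x, so identities are checked by evaluation at x = 2, 3, ..., where x
    and all 1 - x^d are nonzero. *)
Lemma poly_eq_large_nat p q : (forall i : nat, p.[i.+2%:R] = q.[i.+2%:R]) -> p = q.
Proof.
move=> H; apply/eqP; rewrite -subr_eq0; apply/negPn/negP => nz.
pose rs := [seq (i.+2%:R : rat) | i <- iota 0 (size (p - q))].
suff: (size rs < size (p - q)%R)%N by rewrite size_map size_iota ltnn.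
apply: max_poly_roots => //.
  by apply/allP => _ /mapP [i _ ->]; rewrite rootE hornerD hornerN H subrr.
by rewrite map_inj_uniq ?iota_uniq // => i j /eqP; rewrite eqr_nat => /eqP [].
Qed.

(** The polynomial X^n q(1/X) for q = [hilb_numerator]. *)
Definition rev_numerator n mu : {poly rat} :=
  'X^n - (1 + ('X - 1) *+ n + ('X - 1) ^+ 2 *+ mu).

Lemma rev_numeratorE n mu (x : rat) : (2 <= n)%N -> x != 0 ->
  x ^+ n * (hilb_numerator n mu).[x^-1] = (rev_numerator n mu).[x].
Proof.
move=> n2 x0; rewrite /hilb_numerator /rev_numerator !(hornerE, hornerMn, horner_exp).
have -> : x^-1 ^+ n = x^-1 ^+ (n - 2) * x^-1 ^+ 2 by rewrite -exprD subnK.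
have -> : x^-1 ^+ (n - 1) = x^-1 ^+ (n - 2) * x^-1 by rewrite -exprSr; congr (_ ^+ _); lia.
have -> : x ^+ n = x ^+ (n - 2) * x ^+ 2 by rewrite -exprD subnK.
have E : x ^+ (n - 2) * x^-1 ^+ (n - 2) = 1 by rewrite -exprMn divff // expr1n.
set A := x^-1 ^+ (n - 2) in E *; set B := x ^+ (n - 2) in E *.
have -> : A = B^-1 by rewrite /A /B exprVn.
have B0 : B != 0 by rewrite expf_neq0.
field.
by rewrite B0 x0.
Qed.

Lemma horner_palindromic F s (x : rat) : x != 0 ->
  (forall k, (s < k)%N -> F`_k = 0) ->
  (forall k l, (k + l)%N = s -> F`_k = F`_l) ->
  x ^+ s * F.[x^-1] = F.[x].
Proof.
move=> x0 F0 Fs.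
have sF : (size F <= s.+1)%N by apply/leq_sizeP => j sj; apply: F0.
rewrite !(horner_coef_wide _ sF) mulr_sumr [RHS](reindex_inj rev_ord_inj) /=.
apply: eq_bigr => k _; rewrite subSS; have ks : (k <= s)%N by rewrite -ltnS.
rewrite (Fs k (s - k)%N) ?subnKC // mulrCA; congr (_ * _).
by rewrite exprVn -expfB_cond // (negbTE x0).
Qed.

Lemma antipalindromic_factors (ds : seq nat) (x : rat) : x != 0 ->
  x ^+ (\sum_(d <- ds) d)%N * (\prod_(d <- ds) (1 - 'X^d)).[x^-1] =
    (-1) ^+ size ds * (\prod_(d <- ds) (1 - 'X^d)).[x].
Proof.
move=> x0; elim: ds => [|d ds IH]; first by rewrite !big_nil !expr0 !mul1r !hornerE.
have XM p q : (p * q).[x] = p.[x] * q.[x] by rewrite hornerM.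
have YM p q : (p * q).[x^-1] = p.[x^-1] * q.[x^-1] by rewrite hornerM.
rewrite !big_cons XM YM exprD mulrACA IH [size (d :: ds)]/= exprS !(hornerD, hornerN, hornerXn, hornerC).
have -> : x ^+ d * (1 - x^-1 ^+ d) = - (1 - x ^+ d).
  by rewrite mulrBr -exprMn divff // expr1n mulr1 opprB.
ring.
Qed.

(** Substituting 1/x in the identity for F and multiplying by a power of x changes each
    factor at most by a sign, except q, which becomes its reversal; the remaining common
    factors are nonzero at x > 1. *)
Lemma numerator_reversal F n mu s (ds : seq nat) : (2 <= n)%N ->
  all (leq 1) ds ->
  (forall k, (s < k)%N -> F`_k = 0) ->
  (forall k l, (k + l)%N = s -> F`_k = F`_l) ->
  (1 - 'X) ^+ n * F = hilb_numerator n mu * \prod_(d <- ds) (1 - 'X^d) ->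
  exists t b, 'X^t * hilb_numerator n mu = (-1) ^+ b * ('X^s * rev_numerator n mu).
Proof.
move=> n2 ds0 F0 Fs E; exists (\sum_(d <- ds) d)%N, (n + size ds)%N.
apply: poly_eq_large_nat => i; set x := _%:R.
have x0 : x != 0 by rewrite pnatr_eq0.
have D0 : (\prod_(d <- ds) (1 - 'X^d)).[x] != 0.
  rewrite horner_prod; elim: ds ds0 {E} => [_|d ds IH /= /andP [d0 ds0]].
    by rewrite big_nil oner_neq0.
  rewrite big_cons mulf_neq0 ?IH // !hornerE subr_eq0 eq_sym.
  by rewrite /x -natrX -[1]/(1%:R) eqr_nat -(exp1n d) eqn_exp2r.
have ev y : (1 - y) ^+ n * F.[y] = (hilb_numerator n mu).[y] * (\prod_(d <- ds) (1 - 'X^d)).[y].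
  by rewrite -hornerM -E hornerM horner_exp !(hornerD, hornerN, hornerX, hornerC).
have Ex := ev x; have Ey := ev x^-1.
have Fx := horner_palindromic x0 F0 Fs.
have Dx := antipalindromic_factors ds x0.
have Qx := rev_numeratorE mu n2 x0.
have Lx : x ^+ n * (1 - x^-1) ^+ n = (-1) ^+ n * (1 - x) ^+ n.
  by rewrite -!exprMn mulrBr divff // mulr1 mulN1r opprB.
rewrite !hornerM !horner_exp !(hornerN, hornerX, hornerC).
apply: (mulIf D0).
set t := (\sum_(d <- ds) d)%N in Dx *.
have S1 : ((-1) ^+ n * (-1) ^+ n = 1 :> rat) by rewrite -exprMn mulrNN mulr1 expr1n.
have -> : x ^+ t * (hilb_numerator n mu).[x] * (\prod_(d <- ds) (1 - 'X^d)).[x]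
   = x ^+ t * ((1 - x) ^+ n * F.[x]) by rewrite Ex mulrA.
rewrite -Fx.
have -> : x ^+ t * ((1 - x) ^+ n * (x ^+ s * F.[x^-1])) =
   ((-1) ^+ n * (-1) ^+ n) * (x ^+ t * ((1 - x) ^+ n * (x ^+ s * F.[x^-1]))).
  by rewrite S1 mul1r.
have -> : ((-1) ^+ n * (-1) ^+ n) * (x ^+ t * ((1 - x) ^+ n * (x ^+ s * F.[x^-1]))) =
   (-1) ^+ n * x ^+ t * x ^+ s * (((-1) ^+ n * (1 - x) ^+ n) * F.[x^-1]) by ring.
rewrite -Lx.
have -> : (-1) ^+ n * x ^+ t * x ^+ s * (x ^+ n * (1 - x^-1) ^+ n * F.[x^-1]) =
   (-1) ^+ n * x ^+ t * x ^+ s * x ^+ n * ((1 - x^-1) ^+ n * F.[x^-1]) by ring.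
rewrite Ey -Qx exprD.
have -> : (-1) ^+ n * x ^+ t * x ^+ s * x ^+ n *
    ((hilb_numerator n mu).[x^-1] * (\prod_(d <- ds) (1 - 'X^d)).[x^-1]) =
   (-1) ^+ n * x ^+ s * (x ^+ n * (hilb_numerator n mu).[x^-1]) *
   (x ^+ t * (\prod_(d <- ds) (1 - 'X^d)).[x^-1]) by ring.
rewrite Dx; ring.
Qed.

Lemma coef_rev_numerator n mu : (4 <= n)%N ->
  [/\ (rev_numerator n mu)`_0 = n%:R - 1 - mu%:R,
      (rev_numerator n mu)`_1 = mu%:R *+ 2 - n%:R &
      (rev_numerator n mu)`_2 = - mu%:R].
Proof.
move=> n4; have [k ->] : exists k, n = k.+4 by exists (n - 4)%N; lia.
rewrite /rev_numerator sqrrB expr1n.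
split; rewrite !(coefD, coefN, coefMn, coefXn, coefX, coef1, mulr1) /=.
all: by ring.
Qed.

Lemma coef_hilb_numerator n mu : (4 <= n)%N ->
  [/\ (hilb_numerator n mu)`_0 = 1, (hilb_numerator n mu)`_1 = 0 &
      (hilb_numerator n mu)`_2 = - (mu * (n == 4))%:R].
Proof.
move=> n4; have [k ->] : exists k, n = k.+4 by exists (n - 4)%N; lia.
rewrite /hilb_numerator !subSS !subn0.
split; rewrite !(coefMn, coefB, coefD, coefXn, coefMXn, coef1) /=.
all: rewrite ?mul0rn ?addr0 ?subr0 //.
case: k => [|k]; last by rewrite muln0 mul0rn subrr.
by rewrite ltnn subnn -horner_coef0 horner_exp !(hornerD, hornerN, hornerX, hornerC) subr0 expr1n muln1 !add0r.
Qed.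

(** The polynomial q starts with 1 + 0 X.  If t > s, then n - 1 - mu = 0 and the next
    coefficient n - 2 of the reversal would be 0 or a sign; t < s is absurd.  If t = s,
    comparing the coefficients of 1, X, X^2 gives n = 2 mu, and then mu = 0 unless n = 4. *)
Lemma numerator_palindromic_two_edges n mu s t b : (4 <= n)%N ->
  'X^t * hilb_numerator n mu = (-1) ^+ b * ('X^s * rev_numerator n mu) ->
  n = 4%N /\ mu = 2%N.
Proof.
move=> n4 E.
have [q0 q1 q2] := coef_hilb_numerator mu n4.
have [r0 r1 r2] := coef_rev_numerator mu n4.
have [u0 Eu] : exists2 u : rat, (-1) ^+ b = u%:P :> {poly rat} & u = 1 \/ u = -1.
  by rewrite -signr_odd; case: (odd b); [exists (-1); rewrite ?polyCN | exists 1]; auto.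
move=> ue; rewrite {}Eu in E.
have C k : ('X^t * hilb_numerator n mu)`_k = u0 * ('X^s * rev_numerator n mu)`_k.
  by rewrite E coefCM.
have n4q : 4%:R <= n%:R :> rat by rewrite ler_nat.
case: (ltngtP t s) => ts.
- have := C t; rewrite !coefXnM ltnn subnn ts q0 mulr0 => /eqP; rewrite oner_eq0 //.
- have C0 := C s; have C1 := C s.+1; move: C0 C1.
  have lts : (s.+1 < s)%N = false by lia.
  rewrite !coefXnM ltnn subnn ts r0 lts subSnn r1.
  have [E1|ne] := eqVneq s.+1 t; first by rewrite -E1 ltnn subnn q0 => C0 C1; exfalso; case: ue C0 C1 => ->; lra.
  have -> : (s.+1 < t)%N by lia.
  by move=> C0 C1; exfalso; case: ue C0 C1 => ->; lra.
- subst s; have C0 := C t; have C1 := C t.+1; have C2 := C t.+2; move: C0 C1 C2.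
  have lt1 : (t.+1 < t)%N = false by lia.
  have lt2 : (t.+2 < t)%N = false by lia.
  have -> : t.+2 = (t + 2)%N by rewrite addn2.
  rewrite !coefXnM ltnn addn2 lt1 lt2 -addn2 addKn subnn subSnn.
  rewrite q0 q1 q2 r0 r1 r2.
  have [->|n4'] := eqVneq n 4%N.
    rewrite muln1 => C0 C1 _; split=> //; apply/eqP; rewrite -(eqr_nat rat); apply/eqP.
    by case: ue C0 C1 => ->; lra.
  by rewrite muln0 => C0 C1 C2; exfalso; case: ue C0 C1 C2 => ->; lra.
Qed.

End PalindromicNumerator.
(** * Gorenstein complementary edge ideals *)

Section ForwardDirection.
Variables (n : nat) (K : fieldType) (e : rel 'I_n).
Local Notation S := {mpoly K[n]}.
Local Notation I := (@complementary_edge_ideal n K e).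

Lemma quot_dim_ext (U J J' : S -> Prop) r :
  (forall f, J f <-> J' f) -> quot_dim U J r -> quot_dim U J' r.
Proof.
move=> E /quot_dimP [b [bU bs bi]]; apply/quot_dimP; exists b; split=> //.
  by move=> f /bs [c Hc]; exists c; apply/E.
by move=> c /E /bi.
Qed.

Lemma complementary_edge_ideal_homog : homog_closed I.
Proof.
apply: ideal_gen_homog => _ [i [j [_ ->]]]; rewrite prod_complementE.
by eexists; rewrite dhomogX.
Qed.

Lemma hilb_complementary_edge N :
  hilb_below I N.+1 (deg_gen (fun m : {ffun 'I_n -> 'I_N.+1} => ~~ edge_covered e (ffun_zeros m))).
Proof.
move=> k kN; eexists; last exact: coef_deg_gen.
have := hilb_monomial K (fun m => edge_covered e (zero_set m)) kN.
move/(quot_dim_ext (J' := I))=> H; rewrite (eq_card (B := [pred m : {ffun 'I_n -> 'I_N.+1} |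
  ((\sum_i m i)%N == k) && ~~ edge_covered e (zero_set (ffun_mnm m))])).
  by apply: H => f; rewrite complementary_edge_idealE.
move=> m; rewrite !inE; congr (_ && ~~ edge_covered e _).
by apply/setP => i; rewrite !inE mnmE.
Qed.

Lemma homogeneous_degrees (s : seq S) :
  (forall t, t \in s -> exists2 d, (0 < d)%N & t \is d.-homog) ->
  exists ds : seq nat, [/\ size ds = size s, all (leq 1) ds &
    forall i, (i < size s)%N -> s`_i \is (nth 0%N ds i).-homog].
Proof.
elim: s => [|t s IH] Hs; first by exists [::].
have [d d0 hd] := Hs t (mem_head _ _).
have [|ds [sds ds0 hds]] := IH; first by move=> u us; apply: Hs; rewrite inE us orbT.
exists (d :: ds); split=> /= [|| [|i]] //; first by rewrite sds.
  by rewrite d0.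
exact: hds.
Qed.

Lemma gorenstein_numerics : (4 <= n)%N -> no_isolated_vertex e -> gorenstein I ->
  n = 4%N /\ num_edges e = 2%N.
Proof.
move=> n4 hiso [s [[_ hs fin] reg soc]].
have n0 : (0 < n)%N by lia.
have HI : is_ideal I := ideal_gen_ideal _.
have hI := complementary_edge_ideal_homog.
pose J := ideal_adjoin I s.
have HJ : is_ideal J := ideal_adjoin_ideal _ _.
have sJ := ideal_subspace HJ.
have hJ : homog_closed J.
  by apply: ideal_adjoin_homog => // g /hs [d _ hd]; exists d.
have [ds [sds ds0 hds]] := homogeneous_degrees hs.
have [sg [Jtop Jsym]] := hilb_symmetric HJ hJ fin soc (proj1 reg).
pose G N := deg_gen (fun m : {ffun 'I_n -> 'I_N.+1} => ~~ edge_covered e (ffun_zeros m)).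
pose D : {poly rat} := \prod_(d <- ds) (1 - 'X^d).
have HG N : hilb_below J N.+1 (G N * D).
  exact: hilb_below_regular_seq HI hI reg sds hds (@hilb_complementary_edge N).
(* F is read off from a truncation beyond the socle degree; all others agree with it. *)
pose F := \poly_(k < sg.+1) (G sg * D)`_k.
have FE N : eq_below N.+1 F (G N * D).
  apply: eq_below_of_coef => k /HG [r hr ->]; rewrite coef_poly ltnS.
  case: leqP => ks; last by rewrite (Jtop k r ks hr).
  by have [r' hr' ->] := HG sg k ks; rewrite (quot_dim_uniq sJ hr hr').
have F0 k : (sg < k)%N -> F`_k = 0 by move=> sk; rewrite coef_poly ltnNge sk.
have Fsym k l : (k + l)%N = sg -> F`_k = F`_l.
  move=> kl; have [ks ls] : (k < sg.+1)%N /\ (l < sg.+1)%N by lia.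
  have [r hr Er] := HG sg k ks; have [r' hr' Er'] := HG sg l ls.
  by rewrite !coef_poly ks ls Er Er' (Jsym k l r r' kl hr hr').
have E : (1 - 'X) ^+ n * F = hilb_numerator n (num_edges e) * D.
  apply: eq_below_all => N; case: N => [|N].
    by apply: eq_below_of_coef.
  have [r Er] := FE N; have [r' Er'] := deg_gen_uncovered_below N n0 hiso.
  exists (r' * D + (1 - 'X) ^+ n * r); rewrite Er mulrDr mulrA.
  by rewrite Er'; ring.
have n2 : (2 <= n)%N by lia.
have [t [b Eq]] := numerator_reversal n2 ds0 F0 Fsym E.
exact: numerator_palindromic_two_edges n4 Eq.
Qed.

End ForwardDirection.

(** The two edges cover four vertices, so their endpoints are distinct. *)
Lemma two_edges_of_numerics (n : nat) (e : rel 'I_n) : n = 4%N -> num_edges e = 2%N ->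
  simple_graph e -> no_isolated_vertex e -> two_disjoint_edges e.
Proof.
move=> n4 mu2 [eirr eC] hiso.
have edge2 Z : edge_covered e Z && (#|Z| == 2) -> exists i j, e i j /\ Z = [set i; j].
  case/andP => /edge_coveredP [i [j [eij sub]]] /eqP Z2; exists i, j; split=> //.
  by apply/eqP; rewrite eqEcard sub Z2 cards2; case: (_ != _).
have e2 i j : e i j -> edge_covered e [set i; j] && (#|[set i; j]| == 2).
  move=> eij; apply/andP; split; first by apply/edge_coveredP; exists i, j.
  by rewrite cards2 (contraTneq _ eij) // => ->; apply: eirr.
have /eqP/cards2P [Z1 [Z2 [_ EZ]]] :
    #|[set Z : {set 'I_n} | edge_covered e Z && (#|Z| == 2)]| = 2.
  by rewrite cardsE.
have inZ Z : (edge_covered e Z && (#|Z| == 2)) = (Z == Z1) || (Z == Z2).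
  by move/setP/(_ Z): EZ; rewrite !inE.
have [a [b [eab Eab]]] : exists i j, e i j /\ Z1 = [set i; j] by apply: edge2; rewrite inZ eqxx.
have [c [d [ecd Ecd]]] : exists i j, e i j /\ Z2 = [set i; j].
  by apply: edge2; rewrite inZ eqxx orbT.
have cov v : v \in [:: a; b; c; d].
  have [w /e2] := hiso v; rewrite inZ Eab Ecd => /orP [] /eqP /setP /(_ v);
    by rewrite !inE eqxx /= => /esym /orP [] /eqP ->; rewrite eqxx ?orbT.
exists a, b, c, d; split=> //.
  apply/card_uniqP; rewrite /= -[RHS]n4 -[in RHS](card_ord n).
  by apply: eq_card => v; rewrite cov.
have set2_edge u v x y : e x y -> [set u; v] = [set x; y] -> e u v.
  move=> exy E; have := e2 _ _ exy; rewrite -E => /andP [_]; rewrite cards2 => uv.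
  have /setP := E => H; have := H u; have := H v; rewrite !inE !eqxx orbT /= => /esym Hv /esym Hu.
  move: uv; case/orP: Hu => /eqP ->; case/orP: Hv => /eqP -> //; rewrite ?eqxx // => _.
  by rewrite eC.
move=> u v; rewrite -Eab -Ecd -inZ; apply/idP/idP; first exact: e2.
by rewrite inZ Eab Ecd => /orP [] /eqP; apply: set2_edge.
Qed.
(** * Lengths of chains of prime ideals *)

Section KrullDimension.
Variables (n : nat) (K : fieldType).
Local Notation S := {mpoly K[n]}.
Implicit Types (P J : S -> Prop) (m : 'X_{1..n}).

Definition degree_le (B : nat) (f : S) : Prop := forall m, m \in msupp f -> (mdeg m <= B)%N.

Lemma degree_leM B B' f g : degree_le B f -> degree_le B' g -> degree_le (B + B') (f * g).
Proof.
move=> Hf Hg m /msuppM_le /allpairsP [[m1 m2] /= [/Hf H1 /Hg H2 ->]].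
by rewrite mdegD leq_add.
Qed.

Lemma degree_le1 : degree_le 0 1.
Proof. by move=> m; rewrite msupp1 inE => /eqP ->; rewrite mdeg0. Qed.

Lemma degree_leX B f j : degree_le B f -> degree_le (j * B) (f ^+ j).
Proof.
move=> Hf; elim: j => [|j IH]; first by rewrite expr0; apply: degree_le1.
by rewrite exprS mulSn; apply: degree_leM.
Qed.

Lemma degree_le_msize f : degree_le (msize f) f.
Proof. by move=> m /msize_mdeg_lt /ltnW. Qed.

Lemma degree_le_trans B B' f : (B <= B')%N -> degree_le B f -> degree_le B' f.
Proof. by move=> BB Hf m /Hf /leq_trans; apply. Qed.

Definition strict_prime_chain (P : nat -> S -> Prop) (d : nat) : Prop :=
  (forall i, (i <= d)%N -> is_prime_ideal (P i)) /\
  (forall i, (i < d)%N ->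
     (forall f, P i f -> P i.+1 f) /\ (exists f, P i.+1 f /\ ~ P i f)).

(** In a relation modulo P between products f^j b_t, the part with j = 0 lies in P', where
    the b_t are independent; it vanishes, and f can be cancelled because P is prime and does
    not contain f. *)
Lemma indep_mod_prime_step P P' (N : nat) (T : finType) (b : T -> S) f :
  is_prime_ideal P -> is_ideal P' -> (forall g, P g -> P' g) -> P' f -> ~ P f ->
  indep_mod P' b -> indep_mod P (fun u : 'I_N * T => f ^+ u.1 * b u.2).
Proof.
move=> [HP _ Ppr] HP' PP' P'f Pf bi c Hc [j t].
suff H (M : nat) (c' : 'I_M -> T -> K) :
    P (\sum_(j < M) f ^+ j * \sum_t c' j t *: b t) -> forall j t, c' j t = 0.
  apply: (H N (fun j t => c (j, t))).
  suff -> : \sum_(j < N) f ^+ j * (\sum_t c (j, t) *: b t) = \sum_u c u *: (f ^+ u.1 * b u.2).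
    by [].
  rewrite (eq_bigr (fun u => c (u.1, u.2) *: (f ^+ u.1 * b u.2))) => [|[] //].
  rewrite -(pair_bigA _ (fun (j : 'I_N) t => c (j, t) *: (f ^+ j * b t))) /=.
  apply: eq_bigr => j' _; rewrite mulr_sumr.
  by apply: eq_bigr => t' _; rewrite scalerAr.
elim: M c' => [|M IH] c' Hc' j' t'; first by case: j'.
rewrite big_ord_recl expr0 mul1r in Hc'.
have EA' : \sum_(i < M) f ^+ (lift ord0 i) * (\sum_t c' (lift ord0 i) t *: b t) =
    f * \sum_(i < M) f ^+ i * (\sum_t c' (lift ord0 i) t *: b t).
  by rewrite mulr_sumr; apply: eq_bigr => i _; rewrite mulrA -exprS.
rewrite EA' in Hc'.
have c0 : forall t, c' ord0 t = 0.
  apply: bi; rewrite -[X in P' X](addrK (f * \sum_(i < M) f ^+ i * (\sum_t c' (lift ord0 i) t *: b t))).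
  apply: idealB => //; first exact: PP'.
  by rewrite mulrC; case: HP' => _ _; apply.
rewrite [X in P (X + _)]big1 ?add0r in Hc' => [|i _]; last by rewrite c0 scale0r.
case: (Ppr _ _ Hc') => // /IH Hl.
by case: (unliftP ord0 j') => [i ->|->]; [apply: Hl|apply: c0].
Qed.

(** Induction along the chain: N^e products of powers of the f_i, whose degrees grow
    linearly in N, are independent modulo P 0. *)
Lemma strict_chain_indep_family e (P : nat -> S -> Prop) : strict_prime_chain P e ->
  exists D, forall N, exists (T : finType) (b : T -> S),
    [/\ #|T| = (N ^ e)%N, indep_mod (P 0%N) b & forall t, degree_le (D * N) (b t)].
Proof.
elim: e P => [|e IH] P [Ppr Pst].
  exists 0%N => N; exists unit, (fun _ => 1); split; first by rewrite card_unit.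
    move=> c; rewrite (big_pred1 tt) => [Hc []|[] //].
    have [HP P1 _] := Ppr 0%N isT; have [//|ct] := eqVneq (c tt) 0; case: P1.
    by rewrite -[1](scalerK ct); case: (ideal_subspace HP) => _ _; apply.
  by move=> t; apply: degree_le1.
have [D HD] := IH (fun i => P i.+1) (conj (fun i => Ppr i.+1) (fun i => Pst i.+1)).
have [P01 [f [P1f P0f]]] := Pst 0%N isT.
exists (msize f + D)%N => N; have [T [b [cT bi bD]]] := HD N.
exists ('I_N * T)%type, (fun u : 'I_N * T => f ^+ u.1 * b u.2); split.
- by rewrite card_prod card_ord cT expnS.
- by apply: indep_mod_prime_step bi => //; [apply: Ppr | case: (Ppr 1%N isT)].
- move=> u; rewrite mulnDl; apply: degree_leM => //.
  apply: (@degree_le_trans (u.1 * msize f)); last by apply: degree_leX; apply: degree_le_msize.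
  by rewrite mulnC leq_mul2l ltnW ?orbT.
Qed.

(** Modulo the variables in C only monomials in the other variables survive. *)
Lemma span_mod_variables J (C : {set 'I_n}) B : is_ideal J -> (forall i, i \in C -> J 'X_i) ->
  exists (T : finType) (b : T -> S), #|T| = (B.+1 ^ #|~: C|)%N /\ span_mod (degree_le B) J b.
Proof.
move=> HJ HC.
pose Q (m : {ffun 'I_n -> 'I_B.+1}) := m \in pffun_on ord0 (mem (~: C)) predT.
exists {m | Q m}, (fun u => 'X_[ffun_mnm (val u)]); split.
  by rewrite card_sig (eq_card (B := pffun_on ord0 (mem (~: C)) predT)) // card_pffun_on card_ord.
move=> f hf; exists (fun u => f@_(ffun_mnm (val u))).
apply: mpoly_monomial_ind; first exact: ideal_subspace.
move=> m /msupp_sub_box_sum [mf Hm].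
have [i|m' E] := @ffun_mnm_onto n B.+1 m.
  by rewrite ltnS; apply: leq_trans (hf _ mf); rewrite mdegE (bigD1 i) //= leq_addr.
have := Hm _ E; rewrite /Q => nQ.
have [i iC mi] : exists2 i, i \in C & (0 < m i)%N.
  apply: NNPP => no; case/pffun_onP: nQ; split=> //; apply/subsetP => i.
  rewrite !inE; apply: contra => iC; apply: contraT => mi0.
  case: no; exists i => //; rewrite -E mnmE lt0n; exact: mi0.
have Em : m = (m - U_(i) + U_(i))%MM.
  by apply/mnmP => j; rewrite mnmDE mnmBE mnm1E; case: eqVneq => [<-|_] /=; lia.
by rewrite Em mpolyXD; case: HJ => _ _; apply; apply: HC.
Qed.

(** If e > r, the inequality N^e <= (D N + 1)^r between the sizes of the independent and the
    spanning family fails for large N. *)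
Lemma prime_chain_length_le e (P : nat -> S -> Prop) (C : {set 'I_n}) : strict_prime_chain P e ->
  (forall i, i \in C -> P 0%N 'X_i) -> (e <= #|~: C|)%N.
Proof.
move=> chP HC; have [D HD] := strict_chain_indep_family chP.
have [HP _ _] : is_prime_ideal (P 0%N) by case: chP => + _; apply.
set r := #|~: C|; rewrite leqNgt; apply/negP => re.
(* (D N + 1)^r <= (D + 1)^r N^r < N^(r+1) for this N. *)
pose N := (D.+1 ^ r).+1; have [T [b [cT bi bD]]] := HD N.
have [T' [b' [cT' bs]]] := span_mod_variables (D * N) HP HC.
have := indep_card_le (ideal_subspace HP) bs bD bi; rewrite cT cT' leqNgt => /negP; apply.
have H1 : (N ^ r.+1 <= N ^ e)%N by rewrite leq_exp2l // ltnS expn_gt0.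
apply: leq_trans H1; rewrite expnS.
have H2 : ((D * N).+1 ^ r <= (D.+1 * N) ^ r)%N.
  have [->|r0] := posnP r; first by rewrite !expn0.
  by rewrite leq_exp2r // mulSn addnC -addn1 leq_add2l.
apply: leq_ltn_trans H2 _; rewrite expnMn ltn_mul2r expn_gt0 /=.
by rewrite /N ltnSn.
Qed.

Definition kill (C : {set 'I_n}) : n.-tuple S := [tuple if i \in C then 0 else 'X_i | i < n].

Definition variable_prime (C : {set 'I_n}) : S -> Prop := fun f => f \mPo kill C = 0.

(** The ideal generated by the variables in C is the kernel of a substitution into a domain.
    *)
Lemma variable_prime_prime C : is_prime_ideal (variable_prime C).
Proof.
rewrite /variable_prime; split; first split=> [|f g Hf Hg|a f Hf].
- exact: raddf0.
- by rewrite raddfD /= Hf Hg addr0.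
- by rewrite rmorphM /= Hf mulr0.
- by rewrite rmorph1; apply/eqP/oner_neq0.
- move=> f g; rewrite rmorphM /= => /eqP; rewrite mulf_eq0 => /orP [] /eqP; by [left|right].
Qed.

Lemma variable_primeX C i : variable_prime C 'X_i <-> i \in C.
Proof.
rewrite /variable_prime comp_mpolyXU -tnth_nth tnth_mktuple; case: ifP => // _.
split=> // /(congr1 (mcoeff U_(i))); rewrite mcoeffXU eqxx mcoeff0 => /eqP.
by rewrite oner_eq0.
Qed.

Lemma variable_prime_sub (C C' : {set 'I_n}) f : C \subset C' -> variable_prime C f -> variable_prime C' f.
Proof.
move=> /subsetP sCC Hf; rewrite /variable_prime.
have <- : (f \mPo kill C) \mPo kill C' = f \mPo kill C'; last by rewrite Hf raddf0.
rewrite [f \mPo kill C]comp_mpolyEX raddf_sum [RHS]comp_mpolyEX.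
apply: eq_bigr => m _; rewrite [LHS]comp_mpolyZ !comp_mpolyX rmorph_prod; congr (_ *: _).
apply: eq_bigr => i _; rewrite rmorphXn /= !tnth_mktuple; congr (_ ^+ _).
case: ifP => [/sCC -> |_]; first exact: raddf0.
by rewrite comp_mpolyXU -tnth_nth tnth_mktuple.
Qed.

End KrullDimension.
(** * Two disjoint edges *)

Section Substitution.
Variables (n : nat) (K : fieldType).
Local Notation S := {mpoly K[n]}.
Implicit Types (J : S -> Prop) (l : n.-tuple S) (m : 'X_{1..n}).

Lemma ideal_mul_congr J (f f' g g' : S) : is_ideal J ->
  J (f - f') -> J (g - g') -> J (f * g - f' * g').
Proof.
case=> _ HD HM Hf Hg; have -> : f * g - f' * g' = g * (f - f') + f' * (g - g') by ring.
by apply: HD; apply: HM.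
Qed.

Lemma comp_mpoly_congr J l (f : S) : is_ideal J ->
  (forall i, J ('X_i - tnth l i)) -> J (f - (f \mPo l)).
Proof.
move=> HJ Hl; have [J0 _ JZ] := ideal_subspace HJ.
have -> : f - (f \mPo l) = \sum_(m <- msupp f) f@_m *: ('X_[m] - ('X_[m] \mPo l)).
  under eq_bigr do rewrite scalerBr.
  by rewrite sumrB -mpolyE comp_mpolyEX.
apply: subspace_sum; first exact: ideal_subspace.
move=> m _; apply: JZ; rewrite comp_mpolyX [X in X - _]mpolyXE_id.
elim/big_rec2: _ => [|i g g' _ Hg]; first by rewrite subrr.
apply: ideal_mul_congr => //.
elim: (m i) => [|k IH]; first by rewrite !expr0 subrr.
by rewrite !exprS; apply: ideal_mul_congr.
Qed.

Lemma ideal_comap J l : is_ideal J -> is_ideal (fun f : S => J (f \mPo l)).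
Proof.
move=> [J0 JD JM]; split=> [|f g Hf Hg|a f Hf].
- by rewrite raddf0.
- by rewrite raddfD; apply: JD.
- by rewrite rmorphM; apply: JM.
Qed.

Lemma msupp_comp_mpoly (Q : pred 'X_{1..n}) l (f : S) :
  Q 0%MM -> (forall m m', Q m -> Q m' -> Q (m + m')%MM) ->
  (forall i m, m \in msupp (tnth l i) -> Q m) ->
  forall m, m \in msupp (f \mPo l) -> Q m.
Proof.
move=> Q0 QD Ql.
have QM (g h : S) : (forall m, m \in msupp g -> Q m) -> (forall m, m \in msupp h -> Q m) ->
    forall m, m \in msupp (g * h) -> Q m.
  by move=> Hg Hh m /msuppM_le /allpairsP [[m1 m2] /= [/Hg H1 /Hh H2 ->]]; apply: QD.
have Q1 m : m \in msupp (1 : S) -> Q m by rewrite msupp1 inE => /eqP ->.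
rewrite comp_mpolyE; apply: (subspace_sum (J := monomial_ideal Q)) => [|m _].
  exact: monomial_ideal_subspace.
have [_ _] := monomial_ideal_subspace K Q; apply.
elim/big_rec: _ => // i g _ Hg; apply: (QM) => //.
by elim: (m i) => [|k IH]; rewrite ?expr0 // exprS; apply: (QM) => // m'; apply: Ql.
Qed.

End Substitution.

Section BackwardDirection.
Variables (n : nat) (K : fieldType) (e : rel 'I_n) (a b c d : 'I_n).
Hypotheses (abcd_uniq : uniq [:: a; b; c; d]) (abcd_all : forall v, v \in [:: a; b; c; d]).
Hypothesis eE : forall u v, e u v = ([set u; v] == [set a; b]) || ([set u; v] == [set c; d]).
Local Notation S := {mpoly K[n]}.
Local Notation I := (@complementary_edge_ideal n K e).
Implicit Types (m : 'X_{1..n}) (f : S).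

Let Dab : (a == b) = false. Proof. by move: abcd_uniq; rewrite /= !inE; case: eqP. Qed.
Let Dac : (a == c) = false. Proof. by move: abcd_uniq; rewrite /= !inE; case: (a == c); rewrite ?orbT. Qed.
Let Dad : (a == d) = false. Proof. by move: abcd_uniq; rewrite /= !inE; case: (a == d); rewrite ?orbT. Qed.
Let Dbc : (b == c) = false. Proof. by move: abcd_uniq; rewrite /= !inE; case: (b == c); rewrite ?andbF. Qed.
Let Dbd : (b == d) = false. Proof. by move: abcd_uniq; rewrite /= !inE; case: (b == d); rewrite ?orbT ?andbF. Qed.
Let Dcd : (c == d) = false. Proof. by move: abcd_uniq; rewrite /= !inE; case: (c == d); rewrite ?andbF. Qed.
Let dist := (Dab, Dac, Dad, Dbc, Dbd, Dcd, eq_sym b a, eq_sym c a, eq_sym d a,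
             eq_sym c b, eq_sym d b, eq_sym d c, eqxx).

(** The complement of each edge is the other edge. *)
Lemma two_edges_ideal_monomials m : edge_covered e (zero_set m) =
  ((0 < m a) && (0 < m b) || (0 < m c) && (0 < m d))%N.
Proof.
apply/edge_coveredP/idP => [[i [j [eij sub]]]|].
  have pos k : k \notin [set i; j] -> (0 < m k)%N.
    by move=> nk; rewrite lt0n; apply: contra nk => mk; apply: (subsetP sub); rewrite inE.
  by move: eij; rewrite eE => /orP [] /eqP E; rewrite E in pos; apply/orP; [right|left];
    rewrite !pos // !inE !dist.
case/orP => /andP [p q]; [exists c, d | exists a, b]; rewrite eE eqxx ?orbT; split=> //;
  apply/subsetP => k; rewrite !inE => /eqP mk; have := abcd_all k; rewrite !inE;
  by case/or4P => /eqP E; subst k; rewrite ?eqxx ?orbT //; move: p q; rewrite mk.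
Qed.

(** The monomials of (x_a^2, x_c x_d), the image of I under x_b := x_a. *)
Definition dbl_a_pred : pred 'X_{1..n} := fun m => ((2 <= m a) || (0 < m c) && (0 < m d))%N.
(** The monomials of (x_a^2, x_c^2), the image of I under x_b := x_a and x_d := x_c. *)
Definition dbl_ac_pred : pred 'X_{1..n} := fun m => (2 <= m a)%N || (2 <= m c)%N.

Lemma two_edges_idealE f : I f <->
  monomial_ideal (fun m => ((0 < m a) && (0 < m b) || (0 < m c) && (0 < m d))%N) f.
Proof.
rewrite complementary_edge_idealE; split=> H m /H; by rewrite two_edges_ideal_monomials.
Qed.

Lemma le_pair m i j : i != j -> (0 < m i)%N -> (0 < m j)%N -> (U_(i) + U_(j) <= m)%MM.
Proof.
move=> ij mi mj; apply/mnm_lepP => k; rewrite mnmDE !mnm1E.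
case: (eqVneq i k) => [ik|_]; case: (eqVneq j k) => [jk|_] //=; last by rewrite -jk.
  by move: ij; rewrite ik jk eqxx.
by rewrite -ik.
Qed.

Lemma le_double m i : (2 <= m i)%N -> (U_(i) + U_(i) <= m)%MM.
Proof. by move=> mi; apply/mnm_lepP => k; rewrite mnmDE !mnm1E; case: eqVneq => [<-|]. Qed.

Lemma two_edges_ideal_min J f : is_ideal J -> J ('X_a * 'X_b) -> J ('X_c * 'X_d) -> I f -> J f.
Proof.
move=> HJ Jab Jcd /two_edges_idealE; apply: monomial_ideal_min => // m.
case/orP => /andP [p q]; [exists (U_(a) + U_(b))%MM | exists (U_(c) + U_(d))%MM];
  by rewrite ?mpolyXD //; apply: le_pair; rewrite ?dist.
Qed.

Lemma two_edges_ideal_gens : I ('X_a * 'X_b) /\ I ('X_c * 'X_d).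
Proof.
by split; rewrite -mpolyXD; apply/two_edges_idealE/monomial_idealX;
  rewrite !mnmDE !mnm1E !dist ?orbT.
Qed.

Definition glue_ab : n.-tuple S := [tuple if i == b then 'X_a else 'X_i | i < n].
Definition glue_abcd : n.-tuple S :=
  [tuple if i == b then 'X_a else if i == d then 'X_c else 'X_i | i < n].

Lemma glue_abX i : 'X_i \mPo glue_ab = if i == b then 'X_a else 'X_i.
Proof. by rewrite comp_mpolyXU -tnth_nth tnth_mktuple. Qed.

Lemma glue_abcdX i :
  'X_i \mPo glue_abcd = if i == b then 'X_a else if i == d then 'X_c else 'X_i.
Proof. by rewrite comp_mpolyXU -tnth_nth tnth_mktuple. Qed.

Definition sop : seq S := [:: 'X_a - 'X_b; 'X_c - 'X_d].

Lemma dbl_a_up : up_closed dbl_a_pred.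
Proof. by move=> m m'; rewrite /dbl_a_pred !mnmDE; lia. Qed.

Lemma dbl_ac_up : up_closed dbl_ac_pred.
Proof. by move=> m m'; rewrite /dbl_ac_pred !mnmDE; lia. Qed.

Lemma dbl_ac_addU m i :
  dbl_ac_pred (m + U_(i))%MM = ((2 <= m a + (i == a)) || (2 <= m c + (i == c)))%N.
Proof. by rewrite /dbl_ac_pred !mnmDE !mnm1E. Qed.

(** Modulo x_a - x_b every polynomial equals its image under x_b := x_a, and x_a^2 = x_a x_b
    + x_a (x_a - x_b) lies in the enlarged ideal. *)
Lemma adjoin_first_E f :
  ideal_adjoin I [:: 'X_a - 'X_b] f <-> monomial_ideal dbl_a_pred (f \mPo glue_ab).
Proof.
have HJ : is_ideal (ideal_adjoin I [:: 'X_a - 'X_b]) := ideal_adjoin_ideal _ _.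
have HM := monomial_ideal_ideal K dbl_a_up.
have [Iab Icd] := two_edges_ideal_gens; split.
  pose J (h : S) := monomial_ideal dbl_a_pred (h \mPo glue_ab).
  have HJ' : is_ideal J by apply: ideal_comap.
  apply: (ideal_adjoin_min (J := J)) => //.
    move=> h; apply: two_edges_ideal_min => //.
    - rewrite /J rmorphM /= !glue_abX !dist -mpolyXD; apply/monomial_idealX.
      by rewrite /dbl_a_pred !mnmDE !mnm1E !dist.
    - rewrite /J rmorphM /= !glue_abX !dist -mpolyXD; apply/monomial_idealX.
      by rewrite /dbl_a_pred !mnmDE !mnm1E !dist.
  move=> g; rewrite inE => /eqP ->; rewrite /J raddfB /= !glue_abX !dist subrr.
  by case: HM.
move=> Hf; suff Hc : ideal_adjoin I [:: 'X_a - 'X_b] (f - (f \mPo glue_ab)).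
  apply/(ideal_congr HJ Hc); apply: monomial_ideal_min Hf => // m /orP [ma|/andP [mc md]].
    exists (U_(a) + U_(a))%MM; first exact: le_double.
    rewrite mpolyXD; have -> : 'X_a * 'X_a = 'X_a * 'X_b + 'X_a * ('X_a - 'X_b) :> S by ring.
    case: HJ => _ JD JM; apply: JD; first exact: ideal_adjoin_base.
    by apply: JM; apply: ideal_adjoin_in; rewrite mem_head.
  exists (U_(c) + U_(d))%MM; first by apply: le_pair; rewrite ?dist.
  by rewrite mpolyXD; apply: ideal_adjoin_base.
apply: (comp_mpoly_congr _ HJ) => i; rewrite tnth_mktuple; case: eqP => [->|_].
  by rewrite -[X in ideal_adjoin _ _ X]opprB; apply: idealN => //; apply: ideal_adjoin_in; rewrite mem_head.
by rewrite subrr; case: HJ.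
Qed.

Lemma adjoin_sop_E f :
  ideal_adjoin I sop f <-> monomial_ideal dbl_ac_pred (f \mPo glue_abcd).
Proof.
have HJ : is_ideal (ideal_adjoin I sop) := ideal_adjoin_ideal _ _.
have HM := monomial_ideal_ideal K dbl_ac_up.
have [Iab Icd] := two_edges_ideal_gens.
have Jab : ideal_adjoin I sop ('X_a - 'X_b) by apply: ideal_adjoin_in; rewrite mem_head.
have Jcd : ideal_adjoin I sop ('X_c - 'X_d).
  by apply: ideal_adjoin_in; rewrite !inE eqxx orbT.
split.
  pose J (h : S) := monomial_ideal dbl_ac_pred (h \mPo glue_abcd).
  have HJ' : is_ideal J by apply: ideal_comap.
  apply: (ideal_adjoin_min (J := J)) => //.
    move=> h; apply: two_edges_ideal_min => //.
    - rewrite /J rmorphM /= !glue_abcdX !dist -mpolyXD; apply/monomial_idealX.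
      by rewrite /dbl_ac_pred !mnmDE !mnm1E !dist.
    - rewrite /J rmorphM /= !glue_abcdX !dist -mpolyXD; apply/monomial_idealX.
      by rewrite /dbl_ac_pred !mnmDE !mnm1E !dist.
  by move=> g; rewrite !inE => /orP [] /eqP ->; rewrite /J raddfB /= !glue_abcdX !dist subrr;
    case: HM.
have [J0 JD JM] := HJ.
move=> Hf; suff Hc : ideal_adjoin I sop (f - (f \mPo glue_abcd)).
  apply/(ideal_congr HJ Hc); apply: monomial_ideal_min Hf => // m /orP [ma|mc].
    exists (U_(a) + U_(a))%MM; first exact: le_double.
    rewrite mpolyXD; have -> : 'X_a * 'X_a = 'X_a * 'X_b + 'X_a * ('X_a - 'X_b) :> S by ring.
    by apply: JD; [apply: ideal_adjoin_base | apply: JM].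
  exists (U_(c) + U_(c))%MM; first exact: le_double.
  rewrite mpolyXD; have -> : 'X_c * 'X_c = 'X_c * 'X_d + 'X_c * ('X_c - 'X_d) :> S by ring.
  by apply: JD; [apply: ideal_adjoin_base | apply: JM].
apply: (comp_mpoly_congr _ HJ) => i; rewrite tnth_mktuple; case: eqP => [->|_].
  by rewrite -[X in ideal_adjoin _ _ X]opprB; apply: idealN.
case: eqP => [->|_]; first by rewrite -[X in ideal_adjoin _ _ X]opprB; apply: idealN.
by rewrite subrr.
Qed.

Lemma sop_proper : ~ ideal_adjoin I sop 1.
Proof.
move/adjoin_sop_E; rewrite rmorph1 -mpolyX0 => /monomial_idealX.
by rewrite /dbl_ac_pred !mnm0E.
Qed.

(** Both steps reduce to [diff_regular_mod_monomial], for the monomial ideals (x_a x_b, x_c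
    x_d) and (x_a^2, x_c x_d). *)
Lemma sop_regular : regular_seq I sop.
Proof.
split; first exact: sop_proper.
case=> [|[|//]] _ f.
  have HI : is_ideal I := ideal_gen_ideal _.
  rewrite take0 => /(ideal_adjoin_nil _ HI)/two_edges_idealE H.
  apply/(ideal_adjoin_nil _ HI)/two_edges_idealE; move: H.
  apply: diff_regular_mod_monomial => [|m|m]; rewrite ?dist // !mnmDE !mnm1E !dist; lia.
rewrite /= => /adjoin_first_E; rewrite rmorphM rmorphB /= !glue_abX !dist => H.
apply/adjoin_first_E; move: H.
apply: diff_regular_mod_monomial => [|m|m]; rewrite ?dist // /dbl_a_pred !mnmDE !mnm1E !dist; lia.
Qed.

Lemma glue_abcd_support f m : m \in msupp (f \mPo glue_abcd) -> m b = 0%N /\ m d = 0%N.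
Proof.
move=> Hm; suff /andP [/eqP -> /eqP ->] : (m b == 0%N) && (m d == 0%N) by [].
apply: (msupp_comp_mpoly (Q := fun m => (m b == 0%N) && (m d == 0%N))) Hm.
- by rewrite !mnm0E.
- by move=> m1 m2; rewrite !mnmDE; lia.
- move=> i k; rewrite tnth_mktuple.
  case: (eqVneq i b) => [_|ib]; last case: (eqVneq i d) => [_|id].
  all: rewrite msuppX inE => /eqP ->; rewrite !mnm1E ?dist //.
  by rewrite (negbTE ib) (negbTE id).
Qed.

(** The monomials 1, x_a, x_c, x_a x_c. *)
Definition box_mnm (u : bool * bool) : 'X_{1..n} := (U_(a) *+ u.1 + U_(c) *+ u.2)%MM.

Lemma box_mnmE u : [/\ box_mnm u a = u.1, box_mnm u b = 0%N, box_mnm u c = u.2 & box_mnm u d = 0%N].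
Proof.
by case: u => [[] []]; split; rewrite /box_mnm /= !mnmDE !mulmnE !mnm1E !dist.
Qed.

Lemma box_mnm_onto f m : m \in msupp (f \mPo glue_abcd) -> ~~ dbl_ac_pred m ->
  m = box_mnm (0 < m a, 0 < m c)%N.
Proof.
move=> /glue_abcd_support [mb md] nL; have [Ea Eb Ec Ed] := box_mnmE (0 < m a, 0 < m c)%N.
apply/mnmP => i; have := abcd_all i; rewrite !inE.
by case/or4P => /eqP ->; rewrite ?Ea ?Eb ?Ec ?Ed //=; move: nL; rewrite /dbl_ac_pred; lia.
Qed.

Lemma glue_box u : 'X_[K, box_mnm u] \mPo glue_abcd = 'X_[box_mnm u].
Proof.
rewrite /box_mnm !mpolyXD -!mpolyXn rmorphM !rmorphXn /=.
by rewrite !glue_abcdX !dist.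
Qed.

Lemma box_mnm_inj : injective box_mnm.
Proof.
move=> [p q] [p' q'] E; have [Ea _ Ec _] := box_mnmE (p, q); have [Ea' _ Ec' _] := box_mnmE (p', q').
move: Ea Ec; rewrite E Ea' Ec' /=; clear E Ea' Ec'; by case: p; case: p'; case: q; case: q'.
Qed.

Lemma mcoeff_box_combination (v : bool * bool -> K) m :
  (\sum_u v u *: 'X_[K, box_mnm u])@_m = \sum_u v u * (box_mnm u == m)%:R.
Proof.
rewrite (raddf_sum (mcoeff m)) /=.
by apply: eq_bigr => u _; rewrite mcoeffZ mcoeffX.
Qed.

(** The substituted polynomial involves x_a and x_c only, so outside (x_a^2, x_c^2) it has
    at most the monomials 1, x_a, x_c, x_a x_c. *)
Lemma sop_span f :
  ideal_adjoin I sop (f - \sum_u (f \mPo glue_abcd)@_(box_mnm u) *: 'X_[box_mnm u]).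
Proof.
have glueB (v : bool * bool -> K) :
    (\sum_u v u *: 'X_[box_mnm u]) \mPo glue_abcd = \sum_u v u *: 'X_[box_mnm u].
  rewrite (raddf_sum (comp_mpoly glue_abcd)) /=.
  by apply: eq_bigr => u _; rewrite comp_mpolyZ glue_box.
apply/adjoin_sop_E; rewrite comp_mpolyB glueB.
apply/monomial_idealP => m nL; rewrite mcoeffB mcoeff_box_combination.
have [mg|/memN_msupp_eq0 mg] := boolP (m \in msupp (f \mPo glue_abcd)).
  have Em := box_mnm_onto mg nL; set u0 := (_, _) in Em.
  rewrite (bigD1 u0) //= -Em eqxx mulr1 big1 ?addr0 ?subrr // => u ne.
  by rewrite Em (inj_eq box_mnm_inj) (negbTE ne) mulr0.
rewrite mg big1 ?subrr // => u _.
by case: eqP => [->|_]; rewrite ?mulr0 // mg mul0r.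
Qed.

Lemma sop_finite : exists r, quot_dim (fun=> True) (ideal_adjoin I sop) r.
Proof.
apply: (quot_dim_exists (b := fun u => 'X_[box_mnm u])).
  exact/ideal_subspace/ideal_adjoin_ideal.
by move=> f _; eexists; apply: sop_span.
Qed.

(** If x_a f and x_c f vanish in the quotient, the coefficients of the monomials that x_a or
    x_c keeps nonzero vanish, which leaves only x_a x_c. *)
Lemma sop_socle : quot_dim (colon_max (ideal_adjoin I sop)) (ideal_adjoin I sop) 1.
Proof.
exists (fun _ => 'X_[box_mnm (true, true)]); split.
- move=> _ i; apply/adjoin_sop_E; rewrite rmorphM /= glue_box glue_abcdX.
  have [Ea Eb Ec Ed] := box_mnmE (true, true).
  have : (i == b) || (i == d) || ((i == a) || (i == c)).
    by have := abcd_all i; rewrite !inE; case: (i == a); case: (i == b); case: (i == c); case: (i == d).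
  move=> Hi; have [j -> Hj] : exists2 j, (if i == b then 'X_a else if i == d then 'X_c else 'X_i)
      = 'X_j :> S & (j == a) || (j == c).
    case: (i == b) Hi => [_|]; first by exists a; rewrite ?eqxx.
    case: (i == d) => [_|/= Hi]; first by exists c; rewrite ?eqxx ?orbT.
    by exists i.
  rewrite -mpolyXD addmC; apply/monomial_idealX; rewrite dbl_ac_addU Ea Ec.
  by case/orP: Hj => /eqP ->; rewrite !dist ?orbT.
- move=> f Hf; exists (fun _ => (f \mPo glue_abcd)@_(box_mnm (true, true))).
  rewrite big_ord1.
  have van i u : (i == a) || (i == c) -> ~~ dbl_ac_pred (box_mnm u + U_(i))%MM ->
      (f \mPo glue_abcd)@_(box_mnm u) = 0.
    move=> Hi nL; have /adjoin_sop_E := Hf i; rewrite rmorphM /= glue_abcdX.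
    have -> : (if i == b then 'X_a else if i == d then 'X_c else 'X_i) = 'X_i :> S.
      by case/orP: Hi => /eqP ->; rewrite !dist.
    move/monomial_idealP/(_ _ nL); rewrite mcoeffMXU mnmDE mnm1E eqxx addn1 /=.
    by rewrite addmK.
  have := sop_span f; rewrite (bigD1 (true, true)) //= big1 ?addr0 // => -[p q] ne.
  have [Ea Eb Ec Ed] := box_mnmE (p, q).
  case: q Ea Eb Ec Ed ne => /= Ea Eb Ec Ed ne.
    case: p Ea Eb Ec Ed ne => //= Ea Eb Ec Ed _; rewrite (van a) ?scale0r ?eqxx //.
    by rewrite dbl_ac_addU Ea Ec !dist.
  rewrite (van c) ?scale0r ?eqxx ?orbT //.
  by rewrite dbl_ac_addU Ea Ec !dist; case: (p).
- move=> u; rewrite big_ord1 => /adjoin_sop_E; rewrite comp_mpolyZ glue_box.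
  have [Ea Eb Ec Ed] := box_mnmE (true, true).
  move/monomial_idealP/(_ (box_mnm (true, true))).
  rewrite /dbl_ac_pred Ea Ec mcoeffZ mcoeffX eqxx mulr1 => /(_ isT) u0 i.
  by rewrite ord1.
Qed.

(** The chain (x_a, x_c) < (x_a, x_b, x_c) < (all variables) has length 2.  Conversely a
    prime containing I contains an endpoint of each edge, and two variables remain. *)
Lemma two_edges_krull_dim : krull_dim I 2.
Proof.
have n4 : n = 4%N.
  have /card_uniqP := abcd_uniq; rewrite /= => <-; rewrite -[LHS](card_ord n).
  by apply: eq_card => v; rewrite abcd_all.
have [Iab Icd] := two_edges_ideal_gens.
split.
  pose C (i : nat) : {set 'I_n} := if i is 0 then [set a; c] else if i is 1 then [set a; b; c] else setT.
  exists (fun i => variable_prime (K := K) (C i)); split=> [i _|i i2].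
    split; first exact: variable_prime_prime.
    have [HP _ _] := variable_prime_prime K (C i).
    have inC x : x \in [set a; c] -> variable_prime (K := K) (C i) 'X_x.
      move=> xac; apply/variable_primeX; rewrite /C; case: i {HP} => [//|[|i]]; last by rewrite inE.
      by move: xac; rewrite !inE => /orP [] ->; rewrite ?orbT.
    move=> f; apply: two_edges_ideal_min => //; rewrite mulrC; case: HP => _ _; apply.
      by apply: inC; rewrite !inE eqxx.
    by apply: inC; rewrite !inE eqxx orbT.
  split=> [f|].
    apply: variable_prime_sub; case: i i2 => [|[|//]] _; last exact: subsetT.
    by apply/subsetP => x; rewrite !inE => /orP [] ->; rewrite ?orbT.
  by case: i i2 => [|[|//]] _; [exists 'X_b | exists 'X_d]; rewrite !variable_primeX !inE !dist.
move=> e' [P [Pprime Pstrict]].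
have chP : strict_prime_chain P e'.
  by split=> [i /Pprime []//|i /Pstrict].
have [[HP _ Ppr] IP] := Pprime 0%N isT.
have [x xab Px] : exists2 x, x \in [:: a; b] & P 0%N 'X_x.
  by case: (Ppr _ _ (IP _ Iab)) => ?; [exists a | exists b]; rewrite // !inE eqxx ?orbT.
have [y ycd Py] : exists2 y, y \in [:: c; d] & P 0%N 'X_y.
  by case: (Ppr _ _ (IP _ Icd)) => ?; [exists c | exists d]; rewrite // !inE eqxx ?orbT.
have := prime_chain_length_le (C := [set x; y]) chP.
have -> : #|~: [set x; y]| = 2.
  rewrite cardsCs setCK card_ord cards2.
  have -> : x != y by move: xab ycd; rewrite !inE => /orP [] /eqP -> /orP [] /eqP ->; rewrite !dist.
  by rewrite [X in (X - _)%N]n4.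
by apply=> i; rewrite !inE => /orP [] /eqP ->.
Qed.

Lemma two_edges_gorenstein : gorenstein I.
Proof.
exists sop; split; [split; [exact: two_edges_krull_dim | | exact: sop_finite]
  | exact: sop_regular | exact: sop_socle].
move=> t; rewrite !inE => ht; exists 1%N => //.
by case/orP: ht => /eqP ->; apply: rpredB; rewrite dhomogX /= mdeg1.
Qed.

End BackwardDirection.

Theorem corollary1p6 (n : nat) (K : fieldType) (e : rel 'I_n)
    (hn : (4 <= n)%N) (he : simple_graph e) (hiso : no_isolated_vertex e) :
  gorenstein (@complementary_edge_ideal n K e) <-> two_disjoint_edges e.
Proof.
split=> [/(gorenstein_numerics hn hiso) [n4 mu2]|[a [b [c [d [U A E]]]]]].
  exact: two_edges_of_numerics.
exact: (@two_edges_gorenstein n K e a b c d).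
Qed.
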